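(* The functions $\ast\mapsto N_\ast$ and $N\mapsto\ast_N$ are inverse bijections between the set of contours in dimension $\ell$ and the set of simple norms on $\mathrm{tame}([0,\infty)^\ell,\mathrm{vec}_K)$.
   Context: Posets and functors. $[0,\infty)^\ell$ is the poset of $\ell$-tuples of non-negative reals with the coordinatewise order; $[0,\infty)^\ell_\infty$ is obtained by adding a global maximum $\infty$. $K$ is a field and $\mathrm{vec}_K$ is the category of finite dimensional $K$-vector spaces. For $v\in[0,\infty)^\ell$, $K(v,-)\colon[0,\infty)^\ell\to\mathrm{vec}_K$ is the functor with $K(v,x)=K$ if $v\le x$ and $0$ otherwise, with identity maps between nonzero values; $K(\infty,-):=0$. A functor $X\colon[0,\infty)^\ell\to\mathrm{vec}_K$ is tame if it is finitely presented, i.e. isomorphic to the cokernel of a natural transformation between finite direct sums of functors $K(v,-)$, $v\in[0,\infty)^\ell$. Tame functors with natural transformations form an Abelian category $\mathrm{tame}([0,\infty)^\ell,\mathrm{vec}_K)$. $|\beta_0X|$ denotes the minimal number of generators of a tame functor $X$, i.e. the smallest $n$ such that there is an epimorphism $\bigoplus_{i=1}^nK(v_i,-)\to X$ with $v_i\in[0,\infty)^\ell$. Valuations and norms. A valuation on an Abelian category $\mathcal{M}$ is a function $\omega\colon\mathrm{mor}(\mathcal{M})\to[0,\infty]$ with $\omega(f)=0$ for isomorphisms $f$ and $\omega(0\colon X\to Y)=\omega(0\colon Y\to X)$ for all $X,Y$. For commutative squares with top $f\colon X_0\to X_1$, bottom $g\colon Y_0\to Y_1$ and vertical morphisms $X_0\to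 Y_0$, $X_1\to Y_1$: $\omega$ is push-out non-expansive if $\omega(f)\ge\omega(g)$ for push-out squares, and pull-back non-expansive if $\omega(g)\ge\omega(f)$ for pull-back squares. It is composition sub-additive if $\omega(gf)\le\omega(f)+\omega(g)$ for composable $f,g$, and monotone if $\omega(gf)\ge\max\{\omega(f),\omega(g)\}$ for composable $f,g$ with $f$ an epimorphism or $g$ a monomorphism. For $t\in[0,\infty)$, a monomorphism $f\colon A\hookrightarrow X$ is $t$-minimal (with respect to $\omega$) if $\omega(f)\le t$ and, for every monomorphism $g\colon B\hookrightarrow X$ with $\omega(g)\le t$ and every $h\colon B\to A$ with $fh=g$, $h$ is an isomorphism. When a $t$-minimal monomorphism into $X$ exists it is called the $t$-shift of $X$ and its domain is denoted $X[t]\subset X$; for valuations satisfying (0) and (1) below it is unique up to unique isomorphism over $X$. A valuation $\omega$ on $\mathrm{tame}([0,\infty)^\ell,\mathrm{vec}_K)$ is simple if: (0) it is push-out and pull-back non-expansive, composition sub-additive, and monotone; (1) $\omega(f\oplus g)\le\max\{\omega(f),\omega(g)\}$ for all monomorphisms $f,g$; (2) the $t$-shift $X[t]\subset X$ with respect to $\omega$ exists for every $t\in[0,\infty)$ and every $X$; (3) $|\beta_0X[t]|\le|\beta_0X|$ for every $t$ and $X$. A norm on $\mathcal{M}$ is a function $N\colon\mathrm{ob}(\mathcal{M})\to[0,\infty]$ with $N(0)=0$ and $\max\{N(X),N(Z)\}\le N(Y)\le N(X)+N(Z)$ for every exact sequence $0\to X\to Y\to Z\to0$. Its associated (homogeneous)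 valuation is $f\mapsto N(\ker f)+N(\mathrm{coker}f)$. A norm on $\mathrm{tame}([0,\infty)^\ell,\mathrm{vec}_K)$ is simple if its associated homogeneous valuation is simple. Contours. A contour in dimension $\ell$ is a function $\ast\colon[0,\infty)^\ell_\infty\times[0,\infty)\to[0,\infty)^\ell_\infty$ such that: (1) $v\le v\ast t$ for all $v,t$; (2) $v\ast s\le w\ast t$ whenever $v\le w$ and $s\le t$; (3) $(v\ast s)\ast t\le v\ast(s+t)$ for all $v,s,t$; (4) for all $v,w$, the set $\{t\in[0,\infty)\mid v\ast t\ge w\}$ is either empty or of the form $[a,\infty)$ with $a\in[0,\infty)$. The two functions. For a contour $\ast$ and a tame functor $X$, $N_\ast(X):=\inf\{t\in[0,\infty)\mid X(v\le v\ast t)=0\text{ for every }v\in[0,\infty)^\ell\text{ with }v\ast t<\infty\}$ (with $\inf\emptyset=\infty$). For a simple norm $N$, $\ast_N\colon[0,\infty)^\ell_\infty\times[0,\infty)\to[0,\infty)^\ell_\infty$ is defined by letting $v\ast_Nt$ be the unique element of $[0,\infty)^\ell_\infty$ for which the $t$-shift of $K(v,-)$ with respect to the homogeneous valuation associated with $N$ is $K(v,-)[t]=K(v\ast_Nt,-)\subset K(v,-)$ (in particular $\infty\ast_Nt=\infty$, and $v\ast_Nt=\infty$ exactly when $K(v,-)[t]=0$). *)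

(* Defs.v *)
From HB Require Import structures.
From mathcomp Require Import all_boot all_order all_algebra.
From mathcomp Require Import all_classical all_reals ereal.

Set Implicit Arguments.
Unset Strict Implicit.
Unset Printing Implicit Defensive.

Import Order.TTheory GRing.Theory Num.Theory.

Local Open Scope classical_set_scope.
Local Open Scope ring_scope.

(** The categorical notions below only refer to composition and to the zero
  morphisms; they are meant to be used in the Abelian category of tame
  functors, where each of them has its standard meaning. *)

Record pointedCat := PointedCat {
  obj :> Type;
  #[canonical=no] hom : obj -> obj -> Type;
  #[canonical=no] idm : forall X, hom X X;
  #[canonical=no] comp : forall X Y Z, hom Y Z -> hom X Y -> hom X Z;
  #[canonical=no] zerom : forall X Y, hom X Y;
  #[canonical=no] comp1m : forall X Y (f : hom X Y), comp (idm Y) f = f;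
  #[canonical=no] compm1 : forall X Y (f : hom X Y), comp f (idm X) = f;
  #[canonical=no] compA : forall X Y Z W (h : hom Z W) (g : hom Y Z) (f : hom X Y),
    comp h (comp g f) = comp (comp h g) f;
  #[canonical=no] comp0m : forall X Y Z (f : hom X Y), comp (zerom Y Z) f = zerom X Z;
  #[canonical=no] compm0 : forall X Y Z (g : hom Y Z), comp g (zerom X Y) = zerom X Z
}.

Arguments idm {p} X.
Arguments zerom {p} X Y.

Notation "g \c f" := (comp g f) (at level 50, left associativity).

Section CategoryNotions.
Variable M : pointedCat.
Implicit Types X Y Z A B C : M.

Definition is_iso X Y (f : hom X Y) :=
  exists g : hom Y X, g \c f = idm X /\ f \c g = idm Y.

Definition is_mono X Y (f : hom X Y) :=
  forall A (g h : hom A X), f \c g = f \c h -> g = h.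

Definition is_epi X Y (f : hom X Y) :=
  forall A (g h : hom Y A), g \c f = h \c f -> g = h.

Definition is_zero_obj Z :=
  forall X, (forall f : hom X Z, f = zerom X Z) /\
            (forall f : hom Z X, f = zerom Z X).

Definition is_kernel X Y (f : hom X Y) A (i : hom A X) :=
  f \c i = zerom A Y /\
  forall B (g : hom B X), f \c g = zerom B Y -> exists! h : hom B A, i \c h = g.

Definition is_cokernel X Y (f : hom X Y) C (p : hom Y C) :=
  p \c f = zerom X C /\
  forall B (g : hom Y B), g \c f = zerom X B -> exists! h : hom C B, h \c p = g.

Definition short_exact X Y Z (f : hom X Y) (g : hom Y Z) :=
  is_kernel g f /\ is_cokernel f g.

(** In the next two definitions the square has top [f], bottom [g], left
  vertical morphism [a] and right vertical morphism [b]. *)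
Definition is_pushout X0 X1 Y0 Y1 (f : hom X0 X1) (g : hom Y0 Y1)
    (a : hom X0 Y0) (b : hom X1 Y1) :=
  b \c f = g \c a /\
  forall Z (p : hom X1 Z) (q : hom Y0 Z), p \c f = q \c a ->
    exists! r : hom Y1 Z, r \c b = p /\ r \c g = q.

Definition is_pullback X0 X1 Y0 Y1 (f : hom X0 X1) (g : hom Y0 Y1)
    (a : hom X0 Y0) (b : hom X1 Y1) :=
  b \c f = g \c a /\
  forall Z (p : hom Z X1) (q : hom Z Y0), b \c p = g \c q ->
    exists! r : hom Z X0, f \c r = p /\ a \c r = q.

Definition is_coproduct A B S (i : hom A S) (j : hom B S) :=
  forall Z (p : hom A Z) (q : hom B Z),
    exists! r : hom S Z, r \c i = p /\ r \c j = q.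

(** [h] is the direct sum of [f] and [g], formed with the direct sums [S] of
  the domains and [T] of the codomains. *)
Definition is_direct_sum_mor A X B Y (f : hom A X) (g : hom B Y)
    S T (h : hom S T) :=
  exists (i1 : hom A S) (i2 : hom B S) (j1 : hom X T) (j2 : hom Y T),
    [/\ is_coproduct i1 i2, is_coproduct j1 j2,
        h \c i1 = j1 \c f & h \c i2 = j2 \c g].

(** A chosen object underlying a kernel, resp. cokernel, of [f]. The default
  value is irrelevant in an Abelian category. *)
Definition ker X Y (f : hom X Y) : M :=
  match pselect (exists A (i : hom A X), is_kernel f i) with
  | left e => projT1 (cid e)
  | right _ => X
  end.

Definition coker X Y (f : hom X Y) : M :=
  match pselect (exists C (p : hom Y C), is_cokernel f p) with
  | left e => projT1 (cid e)
  | right _ => Y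
  end.

Section ValuationsAndNorms.
Variable R : realType.

Definition morfun := forall X Y, hom X Y -> \bar R.

Implicit Types w : morfun.

Definition is_valuation w :=
  [/\ forall X Y (f : hom X Y), (0 <= w X Y f)%E,
      forall X Y (f : hom X Y), is_iso f -> w X Y f = 0%E
    & forall X Y, w X Y (zerom X Y) = w Y X (zerom Y X)].

Definition pushout_nonexpansive w :=
  forall X0 X1 Y0 Y1 (f : hom X0 X1) (g : hom Y0 Y1)
    (a : hom X0 Y0) (b : hom X1 Y1),
    is_pushout f g a b -> (w _ _ g <= w _ _ f)%E.

Definition pullback_nonexpansive w :=
  forall X0 X1 Y0 Y1 (f : hom X0 X1) (g : hom Y0 Y1)
    (a : hom X0 Y0) (b : hom X1 Y1),
    is_pullback f g a b -> (w _ _ f <= w _ _ g)%E.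

Definition comp_subadditive w :=
  forall X Y Z (g : hom Y Z) (f : hom X Y),
    (w _ _ (g \c f) <= w _ _ f + w _ _ g)%E.

Definition monotone_valuation w :=
  forall X Y Z (g : hom Y Z) (f : hom X Y), is_epi f \/ is_mono g ->
    (maxe (w _ _ f) (w _ _ g) <= w _ _ (g \c f))%E.

Definition direct_sum_max w :=
  forall A X B Y (f : hom A X) (g : hom B Y) S T (h : hom S T),
    is_mono f -> is_mono g -> is_direct_sum_mor f g h ->
    (w _ _ h <= maxe (w _ _ f) (w _ _ g))%E.

(** [f : A -> X] is the [t]-shift of [X], so [A] is the object [X[t]]. *)
Definition t_minimal w (t : {nonneg R}) A X (f : hom A X) :=
  [/\ is_mono f, (w _ _ f <= t%:num%:E)%E
    & forall B (g : hom B X), is_mono g -> (w _ _ g <= t%:num%:E)%E ->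
      forall h : hom B A, f \c h = g -> is_iso h].

Definition is_norm (N : M -> \bar R) :=
  [/\ forall X, (0 <= N X)%E,
      forall Z, is_zero_obj Z -> N Z = 0%E
    & forall X Y Z (f : hom X Y) (g : hom Y Z), short_exact f g ->
      (maxe (N X) (N Z) <= N Y)%E /\ (N Y <= N X + N Z)%E].

Definition homogeneous_valuation (N : M -> \bar R) : morfun :=
  fun X Y f => (N (ker f) + N (coker f))%E.

End ValuationsAndNorms.
End CategoryNotions.

Section Functors.
Variables (disp : Order.disp_t) (P : porderType disp) (K : fieldType).

Record functor := Functor {
  fob :> P -> vectType K;
  fmap : forall x y : P, (x <= y)%O -> 'Hom(fob x, fob y);
  fmap1 : forall x (h : (x <= x)%O), fmap h = \1%VF;
  fmapM : forall x y z (h : (x <= y)%O) (k : (y <= z)%O) (hk : (x <= z)%O),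
    fmap hk = (fmap k \o fmap h)%VF
}.

Record nattrans (X Y : functor) := NatTrans {
  ntcomp :> forall x, 'Hom(X x, Y x);
  ntnat : forall x y (h : (x <= y)%O),
    (ntcomp y \o fmap X h)%VF = (fmap Y h \o ntcomp x)%VF
}.

Lemma nattransP X Y (f g : nattrans X Y) : (forall x, f x = g x) -> f = g.
Proof.
case: f g => [f fn] [g gn] /= fg.
have {fg} e : f = g by apply: functional_extensionality_dep.
by subst g; congr NatTrans; exact: Prop_irrelevance.
Qed.

Program Definition nt_id X := @NatTrans X X (fun=> \1%VF) _.
Next Obligation. by move=> *; rewrite /= comp_lfun1l comp_lfun1r. Qed.

Program Definition nt_comp X Y Z (g : nattrans Y Z) (f : nattrans X Y) :=
  @NatTrans X Z (fun x => (g x \o f x)%VF) _.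
Next Obligation. by move=> *; rewrite /= -comp_lfunA ntnat !comp_lfunA ntnat. Qed.

Program Definition nt_zero X Y := @NatTrans X Y (fun=> 0) _.
Next Obligation. by move=> *; rewrite /= comp_lfun0l comp_lfun0r. Qed.

Program Definition functor_cat :=
  @PointedCat functor nattrans nt_id nt_comp nt_zero _ _ _ _ _.
Next Obligation. by move=> *; apply: nattransP => x /=; rewrite comp_lfun1l. Qed.
Next Obligation. by move=> *; apply: nattransP => x /=; rewrite comp_lfun1r. Qed.
Next Obligation. by move=> *; apply: nattransP => x /=; rewrite comp_lfunA. Qed.
Next Obligation. by move=> *; apply: nattransP => x /=; rewrite comp_lfun0l. Qed.
Next Obligation. by move=> *; apply: nattransP => x /=; rewrite comp_lfun0r. Qed.
Canonical functor_cat.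

(** [option P] is [P] with a global maximum [None] added. *)
Definition leoo (v w : option P) : bool :=
  match v, w with
  | _, None => true
  | None, Some _ => false
  | Some x, Some y => (x <= y)%O
  end.

Lemma leoo_trans : transitive leoo.
Proof. by move=> [y|] [x|] [z|] //=; exact: le_trans. Qed.

Definition pid_hom (m n : nat) : 'Hom('rV[K]_m, 'rV[K]_n) :=
  linfun (mulmxr (pid_mx 1 : 'M[K]_(m, n))).

Lemma pid_homE m n u : pid_hom m n u = u *m pid_mx 1.
Proof. by rewrite lfunE. Qed.

Lemma pid_hom1 (b : bool) : pid_hom b b = \1%VF.
Proof.
apply/lfunP => u; rewrite pid_homE id_lfunE.
by case: b u => u; rewrite ?[u]thinmx0 ?mul0mx // pid_mx_1 mulmx1.
Qed.

Lemma pid_hom_comp (a b c : bool) : (a ==> b) || (c ==> b) ->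
  (pid_hom b c \o pid_hom a b)%VF = pid_hom a c.
Proof.
move=> abc; apply/lfunP => u; rewrite comp_lfunE !pid_homE -mulmxA.
congr (_ *m _); case: a b c abc {u} => [] [] [] //= _;
  by rewrite ?pid_mx_1 ?mul1mx ?mulmx1 //; apply/matrixP => [[]] // ? ? [].
Qed.

(** [K(v,-)]: a space of row vectors whose length is the truth value of
  [v <= x], hence [K] if [v <= x] and [0] otherwise (in particular
  [K(oo,-) = 0]); on a nonzero value, [pid_hom] is the identity. *)
Program Definition Kfun (v : option P) : functor :=
  @Functor (fun x => 'rV[K]_(leoo v (Some x)))
    (fun x y _ => pid_hom (leoo v (Some x)) (leoo v (Some y))) _ _.
Next Obligation. by move=> *; exact: pid_hom1. Qed.
Next Obligation.
move=> v x y z h k hk; rewrite pid_hom_comp //; apply/orP; left; apply/implyP => vx.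
exact: leoo_trans vx _.
Qed.

(** The inclusion of [K(w,-)] in [K(v,-)], for [v <= w]. *)
Program Definition Kincl (v w : option P) (vw : leoo v w) :
    nattrans (Kfun w) (Kfun v) :=
  @NatTrans _ _ (fun x => pid_hom (leoo w (Some x)) (leoo v (Some x))) _.
Next Obligation.
move=> v w vw x y xy; have wv z : leoo w (Some z) ==> leoo v (Some z).
  by apply/implyP; exact: leoo_trans.
rewrite !pid_hom_comp ?wv //; apply/orP; left; apply/implyP => wx.
exact: leoo_trans wx _.
Qed.

Definition prod_hom (U V U' V' : vectType K) (f : 'Hom(U, U')) (g : 'Hom(V, V')) :
    'Hom((U * V)%type, (U' * V')%type) :=
  linfun (fun u : U * V => (f u.1, g u.2)).

Lemma prod_homE (U V U' V' : vectType K) (f : 'Hom(U, U')) (g : 'Hom(V, V')) u :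
  prod_hom f g u = (f u.1, g u.2).
Proof.
have lin : linear (fun u : U * V => (f u.1, g u.2)).
  by move=> a x y /=; rewrite !linearP.
pose h := GRing.isLinear.Build _ _ _ _ _ lin.
pose H : {linear (U * V)%type -> (U' * V')%type} :=
  HB.pack (fun u : U * V => (f u.1, g u.2)) h.
exact: (lfunE H).
Qed.

Program Definition dirsum (X Y : functor) : functor :=
  @Functor (fun x => (X x * Y x)%type)
    (fun x y h => prod_hom (fmap X h) (fmap Y h)) _ _.
Next Obligation.
by move=> *; apply/lfunP => -[u v]; rewrite prod_homE /= !fmap1 !id_lfunE.
Qed.
Next Obligation.
move=> X Y x y z h k hk; apply/lfunP => -[u v]; rewrite comp_lfunE !prod_homE /=.
by rewrite !(fmapM _ h k hk) !comp_lfunE.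
Qed.

(** The direct sum of the functors [K(v,-)] for [v] ranging over [s]. *)
Definition free (s : seq P) : functor :=
  foldr (fun v => dirsum (Kfun (Some v))) (Kfun None) s.

(** The cokernel is taken in the category of all functors. *)
Definition is_tame (X : functor) :=
  exists (s r : seq P) (phi : hom (free s) (free r)) (q : hom (free r) X),
    is_cokernel phi q.

Record tame := Tame { tame_functor :> functor; tameP : is_tame tame_functor }.

Program Definition tame_cat := @PointedCat tame nattrans
  (fun X => nt_id X) (fun X Y Z => @nt_comp X Y Z) (fun X Y => nt_zero X Y)
  _ _ _ _ _.
Next Obligation. exact: (@comp1m functor_cat). Qed.
Next Obligation. exact: (@compm1 functor_cat). Qed.
Next Obligation. exact: (@compA functor_cat). Qed.
Next Obligation. exact: (@comp0m functor_cat). Qed.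
Next Obligation. exact: (@compm0 functor_cat). Qed.
Canonical tame_cat.

Definition generated_by (X : functor) (n : nat) :=
  exists (s : seq P) (q : hom (free s) X), size s = n /\ is_epi q.

Lemma tame_generated X : is_tame X -> exists n, `[< generated_by X n >].
Proof.
case=> [s [r [phi [q [q0 qu]]]]]; exists (size r).
apply/asboolP; exists r, q; split=> // A g h gh.
have e : (h \c q) \c phi = zerom _ A by rewrite -compA q0 compm0.
have [k [_ ku]] := qu A (h \c q) e.
by rewrite -(ku g gh) -(ku h erefl).
Qed.

Definition beta0 (X : tame) : nat := ex_minn (tame_generated (tameP X)).

Lemma Kfun_tame v : is_tame (Kfun v).
Proof.
have Kfun0 x (u : Kfun None x) : u = 0 by rewrite [u]thinmx0.
case: v => [v|]; last first.
  exists [::], [::], (zerom _ _), (idm _); split; first by rewrite compm0.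
  move=> B g _; exists g; split; first by rewrite compm1.
  by move=> h; rewrite compm1 => ->.
pose p1 x : 'Hom(free [:: v] x, Kfun (Some v) x) := linfun fst.
pose i1 x : 'Hom(Kfun (Some v) x, free [:: v] x) := linfun (fun u => (u, 0)).
have p1E x u : p1 x u = u.1 by rewrite lfunE.
have i1E x u : i1 x u = (u, 0).
  have lin : linear (fun u => (u, 0) : free [:: v] x).
    by move=> a y z; congr pair; rewrite /= scaler0 addr0.
  pose H : {linear Kfun (Some v) x -> free [:: v] x} :=
    HB.pack (fun u => (u, 0) : free [:: v] x)
      (GRing.isLinear.Build _ _ _ _ _ lin).
  exact: (lfunE H).
have p1n x y (h : (x <= y)%O) :
    (p1 y \o fmap (free [:: v]) h)%VF = (fmap (Kfun (Some v)) h \o p1 x)%VF.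
  by apply/lfunP => u; rewrite !comp_lfunE !p1E prod_homE.
have i1n x y (h : (x <= y)%O) :
    (i1 y \o fmap (Kfun (Some v)) h)%VF = (fmap (free [:: v]) h \o i1 x)%VF.
  by apply/lfunP => u; rewrite !comp_lfunE !i1E prod_homE /= linear0.
pose q : hom (free [:: v]) (Kfun (Some v)) := NatTrans p1n.
pose i : hom (Kfun (Some v)) (free [:: v]) := NatTrans i1n.
have qi : q \c i = idm _.
  by apply: nattransP => x; apply/lfunP => u;
    rewrite /= comp_lfunE i1E p1E id_lfunE.
have iq : i \c q = idm _.
  apply: nattransP => x; apply/lfunP => -[u z].
  by rewrite /= comp_lfunE i1E p1E id_lfunE /= [z]Kfun0.
exists [::], [:: v], (zerom _ _), q; split; first by rewrite compm0.
move=> B g _; exists (g \c i); split; first by rewrite -compA iq compm1.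
by move=> h <-; rewrite -compA qi compm1.
Qed.

Definition Ktame (v : option P) : tame := Tame (Kfun_tame v).

Variable R : realType.

Definition is_simple_valuation (w : morfun tame_cat R) :=
  [/\ is_valuation w,
      [/\ pushout_nonexpansive w, pullback_nonexpansive w,
          comp_subadditive w & monotone_valuation w],
      direct_sum_max w,
      forall (t : {nonneg R}) (X : tame),
        exists (A : tame) (f : hom A X), t_minimal w t f
    & forall (t : {nonneg R}) (X A : tame) (f : hom A X),
        t_minimal w t f -> (beta0 A <= beta0 X)%N].

Definition is_simple_norm (N : tame -> \bar R) :=
  is_norm (N : tame_cat -> \bar R) /\
  is_simple_valuation (homogeneous_valuation (N : tame_cat -> \bar R)).

Definition is_contour (c : option P -> {nonneg R} -> option P) :=
  [/\ forall v t, leoo v (c v t),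
      forall v w s t, leoo v w -> s <= t -> leoo (c v s) (c w t),
      forall v s t, leoo (c (c v s) t) (c v (s%:num + t%:num)%:nng)
    & forall v w, (forall t, ~~ leoo w (c v t)) \/
        exists a : {nonneg R}, forall t, leoo w (c v t) = (a <= t)].

(** [N_*]; the infimum of the empty set is [+oo] in [\bar R]. *)
Definition contour_norm (c : option P -> {nonneg R} -> option P) (X : tame) :
    \bar R :=
  ereal_inf [set t%:num%:E | t in [set t : {nonneg R} |
    forall (v w : P) (h : (v <= w)%O), c (Some v) t = Some w -> fmap X h = 0]].

(** [K(v,-)[t] = K(w,-)] as subobjects of [K(v,-)]. *)
Definition is_Kshift (N : tame -> \bar R) (v : option P) (t : {nonneg R})
    (w : option P) :=
  exists vw : leoo v w,
    t_minimal (homogeneous_valuation (N : tame_cat -> \bar R)) t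
      (Kincl vw : hom (Ktame w) (Ktame v)).

Definition norm_contour (N : tame -> \bar R) (v : option P) (t : {nonneg R}) :
    option P :=
  xget None [set w | is_Kshift N v t w].

End Functors.

(** The poset [0,oo)^l; [tupleprod] is [tuple] with the coordinatewise order. *)
Definition orthant (R : realType) (l : nat) : porderType _ :=
  l.-tupleprod {nonneg R}.

(* Main.v *)
(** Kernels and cokernels of tame functors are computed pointwise, so
  monomorphisms, exactness, push-outs and pull-backs can be read pointwise.

  For a contour, axiom (4) makes the infimum defining [N_*] attained: [N_* X <= t]
  iff all maps [X(v <= v * t)] vanish. Hence [X[t]] is generated by the elements
  [X(v_i <= v_i * t) g_i], where the [g_i] at [v_i] are generators of [X].

  For a simple norm, axiom (1) and pull-back non-expansiveness make the
  [t]-shift the smallest subobject with cokernel of norm at most [t], whence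
  [w <= v *_N t] iff [N (K(v,-) / K(w,-)) <= t], for [v <= w]. The contour axioms
  follow from the properties of [N], and so does [N X <= t] iff all maps
  [X(v <= v *_N t)] vanish: test against [K(v,-) -> X] in one direction, and cover
  [X] by a sum of quotients [K(v_i,-) / K(v_i *_N t,-)] in the other. *)

Require Import Defs.
From HB Require Import structures.
From mathcomp Require Import all_boot all_order all_algebra.
From mathcomp Require Import all_classical all_reals ereal.

(* [fmap] is also the image of a filter in mathcomp-analysis. *)
Import Defs.

Set Implicit Arguments.
Unset Strict Implicit.
Unset Printing Implicit Defensive.

Import Order.TTheory GRing.Theory Num.Theory.
Local Open Scope ring_scope.

(** The notions of kernel, cokernel, push-out and pull-back are internal to the category of tame
    functors, so reading them pointwise requires pointwise kernels and cokernels to be finitely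
    presented again. This coherence needs only finite joins and a least element in the poset:
    finitely many points then cut it into finitely many cells, each with a least element, and a
    functor constant on the cells is presented by its values at these elements. The argument
    therefore runs over any join-semilattice with a least element. The [t]-shift is only minimal by
    definition. It becomes smallest because axiom (1) closes the subobjects whose cokernel has norm
    at most [t] under intersection; axiom (3) then forces the shift of [K(v,-)], a subfunctor with
    at most one generator, to be some [K(w,-)]. *)

Lemma lfun_exists (K : fieldType) (U V : vectType K) (F : U -> V) :
  linear F -> {f : 'Hom(U, V) | forall u, f u = F u}.
Proof.
move=> lin; pose H : {linear U -> V} :=
  HB.pack F (GRing.isLinear.Build _ _ _ _ _ lin).
by exists (linfun F) => u; exact: (lfunE H).
Qed.

Section LinearMaps.
Variables (K : fieldType) (U V : vectType K) (f : 'Hom(U, V)).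

Lemma lfun0 : f 0 = 0. Proof. exact: linear0. Qed.
Lemma lfunN u : f (- u) = - f u. Proof. exact: linearN. Qed.
Lemma lfunD u v : f (u + v) = f u + f v. Proof. exact: linearD. Qed.
Lemma lfunB u v : f (u - v) = f u - f v. Proof. exact: linearB. Qed.
Lemma lfunZ a u : f (a *: u) = a *: f u. Proof. exact: linearZ. Qed.
Lemma lfunPl a u v : f (a *: u + v) = a *: f u + f v. Proof. exact: linearP. Qed.

End LinearMaps.

(** * Pointwise kernels and cokernels *)

Section PointwiseNotions.
Variables (disp : Order.disp_t) (P : porderType disp) (K : fieldType).
Implicit Types X Y Z A B C : functor P K.

Definition ninj X Y (f : nattrans X Y) := forall x u, f x u = 0 -> u = 0.
Definition nsurj X Y (f : nattrans X Y) := forall x v, exists u, f x u = v.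
Definition nexact X Y Z (f : nattrans X Y) (g : nattrans Y Z) :=
  forall x v, g x v = 0 <-> exists u, f x u = v.

Lemma ninjP X Y (f : nattrans X Y) x : ninj f -> injective (f x).
Proof.
by move=> fi u v uv; apply/eqP; rewrite -subr_eq0; apply/eqP/(fi x);
  rewrite lfunB uv subrr.
Qed.

Lemma ntnatE X Y (f : nattrans X Y) x y (h : (x <= y)%O) u :
  f y (fmap X h u) = fmap Y h (f x u).
Proof. by have /lfunP/(_ u) := ntnat f h; rewrite !comp_lfunE. Qed.

Lemma ntcompE X Y Z (g : nattrans Y Z) (f : nattrans X Y) x u :
  nt_comp g f x u = g x (f x u).
Proof. by rewrite /= comp_lfunE. Qed.

Lemma ntidE X x u : nt_id X x u = u.
Proof. by rewrite /= id_lfunE. Qed.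

Lemma ntzeroE X Y x u : nt_zero X Y x u = 0.
Proof. by rewrite /= zero_lfunE. Qed.

Lemma nt_eq X Y (f g : nattrans X Y) : (forall x u, f x u = g x u) -> f = g.
Proof. by move=> fg; apply: nattransP => x; apply/lfunP. Qed.

Lemma fmap1E X x (h : (x <= x)%O) u : fmap X h u = u.
Proof. by rewrite fmap1 id_lfunE. Qed.

Lemma fmapME X x y z (h : (x <= y)%O) (k : (y <= z)%O) (hk : (x <= z)%O) u :
  fmap X k (fmap X h u) = fmap X hk u.
Proof. by rewrite (fmapM X h k hk) comp_lfunE. Qed.

Lemma nt_exists X Y (F : forall x, X x -> Y x) :
  (forall x, linear (F x)) ->
  (forall x y (h : (x <= y)%O) u, F y (fmap X h u) = fmap Y h (F x u)) ->
  exists f : nattrans X Y, forall x u, f x u = F x u.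
Proof.
move=> lin nat; pose f x := sval (lfun_exists (lin x)).
have fE x u : f x u = F x u by exact: (svalP (lfun_exists (lin x))).
have fn x y (h : (x <= y)%O) : (f y \o fmap X h)%VF = (fmap Y h \o f x)%VF.
  by apply/lfunP => u; rewrite !comp_lfunE !fE nat.
by exists (NatTrans fn).
Qed.

(** Injectivity of [i] makes the pointwise choice of preimages unique, hence linear and natural. *)
Lemma nt_lift A X B (i : nattrans A X) (g : nattrans B X) : ninj i ->
  (forall x b, exists a, i x a = g x b) ->
  exists h : nattrans B A, forall x b, i x (h x b) = g x b.
Proof.
move=> ii ex; pose F x b := sval (cid (ex x b)).
have FE x b : i x (F x b) = g x b by exact: (svalP (cid (ex x b))).
have lin x : linear (F x).
  by move=> a b c; apply: (ninjP ii); rewrite lfunPl !FE lfunPl.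
have nat x y (h : (x <= y)%O) u : F y (fmap B h u) = fmap A h (F x u).
  by apply: (ninjP ii); rewrite ntnatE !FE ntnatE.
by have [h hE] := nt_exists lin nat; exists h => x b; rewrite hE FE.
Qed.

(** The chosen section [s] of [p] need not be linear or natural; its ambiguity lies in the kernel of
    [p], which [g] kills. *)
Lemma nt_colift X C B (p : nattrans X C) (g : nattrans X B) : nsurj p ->
  (forall x u, p x u = 0 -> g x u = 0) ->
  exists h : nattrans C B, forall x u, h x (p x u) = g x u.
Proof.
move=> ps ker; pose s x c := sval (cid (ps x c)).
have sE x c : p x (s x c) = c by exact: (svalP (cid (ps x c))).
have gE x u v : p x u = p x v -> g x u = g x v.
  move=> e; apply/eqP; rewrite -subr_eq0 -lfunB; apply/eqP/ker.
  by rewrite lfunB e subrr.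
pose F x c := g x (s x c).
have lin x : linear (F x).
  by move=> a b c; rewrite /F -lfunPl; apply: gE; rewrite lfunPl !sE.
have nat x y (h : (x <= y)%O) u : F y (fmap C h u) = fmap B h (F x u).
  by rewrite /F -ntnatE; apply: gE; rewrite ntnatE !sE.
have [h hE] := nt_exists lin nat; exists h => x u.
by rewrite hE; apply: gE; rewrite sE.
Qed.

Lemma nt_inverse X Y (f : nattrans X Y) : ninj f -> nsurj f ->
  exists g : nattrans Y X,
    (forall x u, g x (f x u) = u) /\ (forall x v, f x (g x v) = v).
Proof.
move=> fi fs; have [g gE] := nt_lift fi (g := nt_id Y)
  (fun x b => let: ex_intro u e := fs x b in
     ex_intro _ u (etrans e (esym (ntidE b)))).
exists g; split=> x u; last by rewrite gE ntidE.
by apply: (ninjP fi); rewrite gE ntidE.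
Qed.

(** Subfunctors and quotients of [X] both arise from spaces [V x] that are
  retracts of the [X x]. *)
Section Retract.
Variables (X : functor P K) (V : P -> vectType K).
Variables (s : forall x, 'Hom(V x, X x)) (r : forall x, 'Hom(X x, V x)).
Hypothesis sK : forall x v, r x (s x v) = v.
Hypothesis rs : forall x y z (h : (x <= y)%O) (k : (y <= z)%O) v,
  r z (fmap X k (s y (r y (fmap X h (s x v))))) =
  r z (fmap X k (fmap X h (s x v))).

Program Definition retract_functor :=
  @Functor _ P K V (fun x y h => (r y \o fmap X h \o s x)%VF) _ _.
Next Obligation. by move=> x h; apply/lfunP => u; rewrite !comp_lfunE fmap1E sK id_lfunE. Qed.
Next Obligation.
by move=> x y z h k hk; apply/lfunP => u; rewrite !comp_lfunE /= rs (fmapME _ _ hk).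
Qed.

End Retract.

Lemma kernel_exists X Y (f : nattrans X Y) :
  exists A (i : nattrans A X), ninj i /\ nexact i f.
Proof.
pose V x : vectType K := subvs_of (lker (f x)).
pose s x := sval (@lfun_exists K (V x) (X x) vsval (@linearP _ _ _ _ vsval)).
have sE x (u : V x) : s x u = vsval u by rewrite /s; case: lfun_exists => g /= ->.
pose r x := sval (@lfun_exists K (X x) (V x) (vsproj _)
  (@linearP _ _ _ _ (vsproj _))).
have rE x u : r x u = vsproj _ u by rewrite /r; case: lfun_exists => g /= ->.
have fs x (u : V x) : f x (s x u) = 0.
  by apply/eqP; rewrite -memv_ker sE subvsP.
have sr x u : f x u = 0 -> s x (r x u) = u.
  by move=> fu; rewrite sE rE vsprojK // memv_ker fu.
have sK x v : r x (s x v) = v by rewrite rE sE vsvalK.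
have rs x y z (h : (x <= y)%O) (k : (y <= z)%O) v :
  r z (fmap X k (s y (r y (fmap X h (s x v))))) =
  r z (fmap X k (fmap X h (s x v))).
  by rewrite sr // ntnatE fs lfun0.
have sn x y (h : (x <= y)%O) :
    (s y \o fmap (retract_functor sK rs) h)%VF = (fmap X h \o s x)%VF.
  by apply/lfunP => u; rewrite !comp_lfunE /= sr // ntnatE fs lfun0.
exists (retract_functor sK rs), (NatTrans sn); split=> x u /=.
  by move=> u0; rewrite -[u]sK u0 lfun0.
by split=> [fu|[a <-]]; [exists (r x u); rewrite sr|rewrite fs].
Qed.

(** The quotient by the image [U x] is modelled on a complement [W x], with the projection along
    [U x] as retraction. The complements are not preserved by the structure maps, but the error lies
    in the images, which are preserved and which the projection kills. *)
Lemma cokernel_exists X Y (f : nattrans X Y) :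
  exists C (p : nattrans Y C), nsurj p /\ nexact f p.
Proof.
pose U x := limg (f x); pose W x := (U x)^C%VS.
pose V x : vectType K := subvs_of (W x).
pose s x := sval (@lfun_exists K (V x) (Y x) vsval (@linearP _ _ _ _ vsval)).
have sE x (u : V x) : s x u = vsval u by rewrite /s; case: lfun_exists => g /= ->.
have [r rE] : {r : forall x, 'Hom(Y x, V x) |
    forall x u, r x u = vsproj _ (daddv_pi (W x) (U x) u)}.
  exists (fun x => sval (@lfun_exists K (Y x) (V x) (vsproj _)
    (@linearP _ _ _ _ (vsproj _))) \o daddv_pi (W x) (U x))%VF => x u.
  by rewrite comp_lfunE; case: lfun_exists => g /= ->.
have WU x : (W x :&: U x)%VS = 0%VS by rewrite capvC capv_compl.
have sK x v : r x (s x v) = v.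
  by rewrite rE sE daddv_pi_id ?subvsP // vsvalK.
have srE x u : s x (r x u) = daddv_pi (W x) (U x) u.
  by rewrite sE rE vsprojK // memv_pi.
have dec x u : daddv_pi (W x) (U x) u + daddv_pi (U x) (W x) u = u.
  by apply: daddv_pi_add (WU x) _; rewrite addvC addv_complf memvf.
have sr x u : u - s x (r x u) \in U x.
  have e := dec x u; rewrite srE.
  have -> : u - daddv_pi (W x) (U x) u = daddv_pi (U x) (W x) u.
    by apply/eqP; rewrite subr_eq addrC e.
  exact: memv_pi.
have kr x u : u \in U x -> r x u = 0.
  move=> uU; have := dec x u.
  rewrite [daddv_pi (U x) _ u]daddv_pi_id ?capv_compl // -srE => e.
  by rewrite -[r x u]sK -[s x _](addrK u) e subrr lfun0.
have UF x y (h : (x <= y)%O) u : u \in U x -> fmap Y h u \in U y.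
  by move=> /memv_imgP [a _ ->]; rewrite -ntnatE memv_img ?memvf.
have rn x y (h : (x <= y)%O) v : r y (fmap Y h (s x (r x v))) = r y (fmap Y h v).
  apply/eqP; rewrite eq_sym -subr_eq0 -!lfunB; apply/eqP/kr/UF; exact: sr.
have rs x y z (h : (x <= y)%O) (k : (y <= z)%O) v :
  r z (fmap Y k (s y (r y (fmap Y h (s x v))))) =
  r z (fmap Y k (fmap Y h (s x v))) by rewrite rn.
have rnat x y (h : (x <= y)%O) :
    (r y \o fmap Y h)%VF = (fmap (retract_functor sK rs) h \o r x)%VF.
  by apply/lfunP => u; rewrite !comp_lfunE rn.
exists (retract_functor sK rs), (@NatTrans _ P K Y (retract_functor sK rs) r rnat).
split=> x u /=.
  by exists (s x u); rewrite sK.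
split=> [ru|[a <-]]; last by rewrite kr // memv_img ?memvf.
have := sr x u; rewrite ru lfun0 subr0 => /memv_imgP [a _ ->].
by exists a.
Qed.

End PointwiseNotions.

(** * Direct sums of functors *)

Section DirectSums.
Variables (disp : Order.disp_t) (P : porderType disp) (K : fieldType).
Implicit Types X Y Z : functor P K.

Lemma dirsum_fmapE X Y x y (h : (x <= y)%O) (u : dirsum X Y x) :
  fmap (dirsum X Y) h u = (fmap X h u.1, fmap Y h u.2).
Proof. exact: prod_homE. Qed.

Lemma copair_exists X Y Z (p : nattrans X Z) (q : nattrans Y Z) :
  exists r : nattrans (dirsum X Y) Z, forall x u, r x u = p x u.1 + q x u.2.
Proof.
apply: nt_exists => [x a u v|x y h u] /=.
  by rewrite !lfunPl scalerDr addrACA.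
by rewrite dirsum_fmapE /= !ntnatE lfunD.
Qed.

Lemma pair_exists X Y Z (p : nattrans Z X) (q : nattrans Z Y) :
  exists r : nattrans Z (dirsum X Y), forall x u, r x u = (p x u, q x u).
Proof.
apply: nt_exists => [x a u v|x y h u] /=.
  by rewrite !lfunPl.
by rewrite dirsum_fmapE /= !ntnatE.
Qed.

Lemma opp_exists X Y (g : nattrans X Y) :
  exists ng : nattrans X Y, forall x u, ng x u = - g x u.
Proof.
apply: nt_exists => [x c u v|x y h u]; last by rewrite ntnatE lfunN.
by rewrite lfunPl opprD scalerN.
Qed.

Lemma prod_exists X Y X' Y' (p : nattrans X X') (q : nattrans Y Y') :
  exists r : nattrans (dirsum X Y) (dirsum X' Y'),
    forall x u, r x u = (p x u.1, q x u.2).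
Proof.
apply: nt_exists => [x a u v|x y h u] /=.
  by rewrite !lfunPl.
by rewrite !dirsum_fmapE /= !ntnatE.
Qed.

Lemma inl_exists X Y :
  exists i : nattrans X (dirsum X Y), forall x u, i x u = (u, 0).
Proof.
have [i iE] := pair_exists (nt_id X) (nt_zero X Y).
by exists i => x u; rewrite iE ntidE ntzeroE.
Qed.

Lemma inr_exists X Y :
  exists i : nattrans Y (dirsum X Y), forall x u, i x u = (0, u).
Proof.
have [i iE] := pair_exists (nt_zero Y X) (nt_id Y).
by exists i => x u; rewrite iE ntidE ntzeroE.
Qed.

Lemma fst_exists X Y :
  exists p : nattrans (dirsum X Y) X, forall x u, p x u = u.1.
Proof.
have [p pE] := copair_exists (nt_id X) (nt_zero Y X).
by exists p => x u; rewrite pE ntidE ntzeroE addr0.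
Qed.

Lemma snd_exists X Y :
  exists p : nattrans (dirsum X Y) Y, forall x u, p x u = u.2.
Proof.
have [p pE] := copair_exists (nt_zero X Y) (nt_id Y).
by exists p => x u; rewrite pE ntidE ntzeroE add0r.
Qed.

End DirectSums.

(** * The functors [K(v,-)] and the Yoneda lemma *)

Section Representables.
Variables (disp : Order.disp_t) (P : porderType disp) (K : fieldType).
Implicit Types (X : functor P K) (v w : option P) (x y : P).

Definition Kgen v x : Kfun K v x := const_mx 1.

Lemma pid_const (b c : bool) : (b ==> c) ->
  pid_hom K b c (const_mx 1) = if b then const_mx 1 else 0.
Proof.
rewrite pid_homE; case: b; case: c => //= _.
- by rewrite pid_mx_1 mulmx1.
- by apply/matrixP => i j; rewrite !mxE big_ord0.
- by apply/matrixP => i j; rewrite !mxE big_ord0.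
Qed.

Lemma Kfun_notin v x (u : Kfun K v x) : ~~ leoo v (Some x) -> u = 0.
Proof.
rewrite /= in u *; case: (leoo v (Some x)) u => // u _.
exact: thinmx0.
Qed.

Lemma Kgen_span v x (u : Kfun K v x) : exists a, u = a *: Kgen v x.
Proof.
rewrite /Kgen /= in u *; case: (leoo v (Some x)) u => u.
  exists (u 0 0); apply/matrixP => i j.
  by rewrite !mxE mulr1 !ord1.
by exists 0; rewrite [u]thinmx0 scale0r.
Qed.

Lemma Kgen_neq0 v x : leoo v (Some x) -> Kgen v x <> 0.
Proof.
rewrite /Kgen /=; case: (leoo v (Some x)) => // _ /matrixP /(_ 0 0).
by rewrite !mxE => /eqP; rewrite oner_eq0.
Qed.

Lemma Kgen_fmap v x y (h : (x <= y)%O) : leoo v (Some x) ->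
  fmap (Kfun K v) h (Kgen v x) = Kgen v y.
Proof.
move=> vx; rewrite /Kgen /= pid_const vx //=.
by apply: leoo_trans vx _.
Qed.

Lemma Kgen_incl v w (vw : leoo v w) x : leoo w (Some x) ->
  Kincl K vw x (Kgen w x) = Kgen v x.
Proof.
move=> wx; rewrite /Kgen /= pid_const wx //=.
by apply: leoo_trans wx.
Qed.

Lemma Kincl_ninj v w (vw : leoo v w) : ninj (Kincl K vw).
Proof.
move=> x u; have [wx|wx] := boolP (leoo w (Some x)); last first.
  by rewrite (Kfun_notin u wx).
have [a ->] := Kgen_span u; rewrite lfunZ Kgen_incl // => /eqP.
rewrite scaler_eq0 => /orP[/eqP -> |/eqP/Kgen_neq0]; first by rewrite scale0r.
by case; exact: leoo_trans vw wx.
Qed.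

Lemma Kincl_surj v w (vw : leoo v w) x u : leoo w (Some x) ->
  exists a, Kincl K vw x a = u.
Proof.
move=> wx; have [a ->] := Kgen_span u.
by exists (a *: Kgen w x); rewrite lfunZ Kgen_incl.
Qed.

Lemma yoneda X x (u : X x) :
  exists f : nattrans (Kfun K (Some x)) X, f x (Kgen (Some x) x) = u.
Proof.
(* Matching on [boolP] provides the proof of [x <= y] that [fmap] takes as an argument. *)
pose tr y : X y := if boolP (x <= y)%O is AltTrue h then fmap X h u else 0.
have trE y (h : (x <= y)%O) : tr y = fmap X h u.
  rewrite /tr; case: {-}_ / boolP => [h'|]; last by rewrite h.
  by rewrite (bool_irrelevance h h').
(* The row [r] has length 0 or 1; a sum over its entries treats both cases without a cast. *)
pose F y (r : Kfun K (Some x) y) : X y := \sum_i (r 0 i) *: tr y.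
have lin y : linear (F y).
  move=> a r s; rewrite /F scaler_sumr -big_split; apply: eq_bigr => i _ /=.
  by rewrite !mxE scalerDl scalerA.
have FE y : (x <= y)%O -> F y (Kgen (Some x) y) = tr y.
  rewrite /F /Kgen /= => ->.
  by rewrite big_ord1 mxE scale1r.
have F0 y : F y 0 = 0.
  by rewrite /F big1 // => i _; rewrite mxE scale0r.
have FZ y a r : F y (a *: r) = a *: F y r.
  by rewrite -[a *: r]addr0 lin F0 addr0.
have nat y z (h : (y <= z)%O) r : F z (fmap (Kfun K (Some x)) h r) = fmap X h (F y r).
  have [xy|xy] := boolP (x <= y)%O; last first.
    by rewrite (Kfun_notin r xy) lfun0 !F0 lfun0.
  have xz := le_trans xy h; have [a ->] := Kgen_span r.
  by rewrite lfunZ Kgen_fmap // !FZ !FE // lfunZ (trE _ xy) (trE _ xz) (fmapME xy h xz).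
have [f fE] := nt_exists lin nat.
by exists f; rewrite fE FE // (trE _ (lexx x)) fmap1E.
Qed.

Lemma nt_gen_fmap x X y (h : (x <= y)%O) (f : nattrans (Kfun K (Some x)) X) :
  f y (Kgen (Some x) y) = fmap X h (f x (Kgen (Some x) x)).
Proof. by rewrite -ntnatE Kgen_fmap /=. Qed.

End Representables.

(** * Coherence *)

Section FinitelyDetermined.
Variables (disp : Order.disp_t) (P : porderType disp) (K : fieldType).
Implicit Types (X Y Z : functor P K) (S : seq P).

(** [X] is constant on the cells cut out by the up-sets of the points of [S].
  Tameness is equivalent to [fdet S X] for some [S], and this condition is
  inherited by pointwise kernels and cokernels, which gives coherence. *)
Definition fdet S X := forall x y (h : (x <= y)%O),
  (forall p, p \in S -> (p <= y)%O -> (p <= x)%O) ->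
  (forall u, fmap X h u = 0 -> u = 0) /\ (forall v, exists u, fmap X h u = v).

Lemma fdetW S S' X : {subset S <= S'} -> fdet S X -> fdet S' X.
Proof. by move=> SS' SX x y h hS; apply: SX => p /SS'; exact: hS. Qed.

Lemma fdet_inj S X x y (h : (x <= y)%O) : fdet S X ->
  (forall p, p \in S -> (p <= y)%O -> (p <= x)%O) -> injective (fmap X h).
Proof.
move=> SX hS u v uv; apply/eqP; rewrite -subr_eq0; apply/eqP.
by apply: (SX x y h hS).1; rewrite lfunB uv subrr.
Qed.

Lemma fdet_Kfun v : fdet (if v is Some x then [:: x] else [::]) (Kfun K v).
Proof.
move=> x y h hS.
have xy : leoo v (Some y) -> leoo v (Some x).
  by case: v hS => [v|] //= hS; apply: hS; rewrite mem_head.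
have [vy|vy] := boolP (leoo v (Some y)); last first.
  have vx : ~~ leoo v (Some x).
    by apply: contra vy => vx; apply: leoo_trans vx _.
  split=> u; first by rewrite (Kfun_notin u vx).
  by exists 0; rewrite [LHS](Kfun_notin _ vy) (Kfun_notin u vy).
split=> u; have [a ->] := Kgen_span u.
  rewrite lfunZ Kgen_fmap ?xy // => /eqP.
  rewrite scaler_eq0 => /orP[/eqP ->|/eqP/Kgen_neq0]; first by rewrite scale0r.
  by case.
by exists (a *: Kgen K v x); rewrite lfunZ Kgen_fmap ?xy.
Qed.

Lemma fdet_dirsum S X Y : fdet S X -> fdet S Y -> fdet S (dirsum X Y).
Proof.
move=> SX SY x y h hS; have [Xi Xs] := SX x y h hS; have [Yi Ys] := SY x y h hS.
split=> -[u v].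
  by rewrite dirsum_fmapE /= => -[/Xi -> /Yi ->].
have [a <-] := Xs u; have [b <-] := Ys v.
by exists (a, b); rewrite dirsum_fmapE.
Qed.

(** A chase in the style of the five lemma: an element of [A y] is lifted in [X], and injectivity on
    [Y] shows that the lift is in the kernel. *)
Lemma fdet_kernel S X Y A (i : nattrans A X) (f : nattrans X Y) :
  ninj i -> nexact i f -> fdet S X -> fdet S Y -> fdet S A.
Proof.
move=> ii ie SX SY x y h hS; have [Xi Xs] := SX x y h hS.
split=> [u u0|v].
  by apply: (ii x); apply: Xi; rewrite -ntnatE u0 lfun0.
have [w wE] := Xs (i y v).
have fw : f x w = 0.
  apply: (fdet_inj (h := h) SY hS); rewrite lfun0 -ntnatE wE.
  by apply/ie; exists v.
have [a aE] := (ie x w).1 fw.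
by exists a; apply: (ninjP ii); rewrite ntnatE aE.
Qed.

Lemma fdet_cokernel S X Y C (f : nattrans X Y) (p : nattrans Y C) :
  nsurj p -> nexact f p -> fdet S X -> fdet S Y -> fdet S C.
Proof.
move=> ps pe SX SY x y h hS; have [Xi Xs] := SX x y h hS.
have [Yi Ys] := SY x y h hS.
split=> u.
  have [v <-] := ps x u; rewrite -ntnatE => /pe [w wE].
  have [w' w'E] := Xs w; apply/pe; exists w'.
  by apply: (fdet_inj (h := h) SY hS); rewrite -ntnatE w'E.
have [v <-] := ps y u; have [v' <-] := Ys v.
by exists (p x v'); rewrite -ntnatE.
Qed.

Lemma fdet_free s : fdet s (free K s).
Proof.
elim: s => [|v s IH] /=; first exact: (@fdet_Kfun None).
apply: fdet_dirsum; last by apply: fdetW IH => p; rewrite inE orbC => ->.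
apply: fdetW (@fdet_Kfun (Some v)) => p.
by rewrite inE => /eqP ->; rewrite mem_head.
Qed.

Lemma free_add_generator s X (q : nattrans (free K s) X) p (u : X p) :
  exists q' : nattrans (free K (p :: s)) X,
    (forall x a, exists b, q' x b = q x a) /\ (exists b, q' p b = u).
Proof.
have [f fE] := yoneda u; have [r rE] := copair_exists f q; exists r.
split=> [x a|]; first by exists (0, a); rewrite rE lfun0 add0r.
by exists (Kgen K (Some p) p, 0); rewrite rE fE lfun0 addr0.
Qed.

Lemma free_add_generators s X (q : nattrans (free K s) X) p (us : seq (X p)) :
  exists s' (q' : nattrans (free K s') X),
    (forall x a, exists b, q' x b = q x a) /\
    (forall u, u \in us -> exists b, q' p b = u).
Proof.
elim: us => [|u us [s' [q' [q'q q'u]]]]; first by exists s, q; split=> // x a; exists a.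
have [q2 [q2q q2u]] := free_add_generator q' u; exists (p :: s'), q2.
split=> [x a|v].
  by have [b <-] := q'q x a; exact: q2q.
rewrite inE => /orP[/eqP -> //|/q'u [b <-]]; exact: q2q.
Qed.

Lemma free_onto_points X (T : seq P) :
  exists s (q : nattrans (free K s) X),
    forall p, p \in T -> forall u, exists b, q p b = u.
Proof.
elim: T => [|p T [s [q qT]]].
  by exists [::], (nt_zero _ _).
have [s' [q' [q'q q'u]]] := free_add_generators q (vbasis (@fullv K (X p))).
exists s', q' => r; rewrite inE => /orP[/eqP -> u|/qT rT u]; last first.
  by have [b <-] := rT u; exact: q'q.
pose e := vbasis (@fullv K (X p)).
have gE (i : 'I_(\dim (@fullv K (X p)))) : exists b, q' p b = e`_i.
  by apply: q'u; rewrite mem_nth // size_tuple.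
pose g i := sval (cid (gE i)).
exists (\sum_i coord e i u *: g i).
rewrite [RHS](coord_vbasis (memvf u)) linear_sum; apply: eq_bigr => i _.
by rewrite linearZ /=; congr (_ *: _); exact: (svalP (cid (gE i))).
Qed.

End FinitelyDetermined.

(** * Finite presentation from finite determination *)

Section Tameness.
Variables (disp : Order.disp_t) (P : joinSemilatticeType disp) (K : fieldType).
Variables (bt : P).
Hypothesis btP : forall x, (bt <= x)%O.
Implicit Types (X Y Z : functor P K) (S : seq P).

(** [T] consists of the joins of [bt] with sublists of [S]; the floor of [x] is the join of the
    points of [S] below [x], the least element of the cell of [x]. *)
Lemma floor_exists S : exists T : seq P, forall x, exists2 p, p \in T &
  (p <= x)%O /\ forall q, q \in S -> (q <= x)%O -> (q <= p)%O.
Proof.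
elim: S => [|s S [T TP]]; first by exists [:: bt] => x; exists bt; rewrite ?mem_head.
exists (T ++ [seq Order.join s t | t <- T]) => x.
have [p pT [px pS]] := TP x; have [sx|sx] := boolP (s <= x)%O.
  exists (Order.join s p); first by rewrite mem_cat map_f ?orbT.
  rewrite leUx sx px; split=> // q; rewrite inE => /orP[/eqP ->|qS qx].
    by rewrite leUl.
  by apply: le_trans (pS q qS qx) _; rewrite leUr.
exists p; first by rewrite mem_cat pT.
split=> // q; rewrite inE => /orP[/eqP ->|]; last exact: pS.
by move=> sx'; rewrite sx' in sx.
Qed.

Lemma fdet_generated S X : fdet S X ->
  exists s (q : nattrans (free K s) X), nsurj q.
Proof.
move=> SX; have [T TP] := floor_exists S.
have [s [q qT]] := free_onto_points X T; exists s, q => x v.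
have [p pT [px pS]] := TP x; have [_ Xs] := SX p x px pS.
by have [w <-] := Xs v; have [b <-] := qT p pT w; exists (fmap _ px b); rewrite ntnatE.
Qed.

(** Only the universal property against [C] and [Q] is assumed, so that this
  applies both to tame functors and to all functors. *)
Lemma universal_cokernel_pointwise X Y C Q
    (f : nattrans X Y) (p : nattrans Y C) (pi : nattrans Y Q) :
  (forall x u, p x (f x u) = 0) -> nsurj pi -> nexact f pi ->
  (exists h : nattrans C Q, nt_comp h p = pi) ->
  (forall h : nattrans C C, nt_comp h p = p -> h = nt_id C) ->
  nsurj p /\ nexact f p.
Proof.
move=> pf pis pie [h hp] uniq.
have kerp x u : pi x u = 0 -> p x u = 0 by move=> /pie [v <-].
(* [k] goes from the pointwise cokernel [Q] back to [C], and uniqueness gives [k \c h = id]: so [h]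
   is injective and [k] surjective. *)
have [k kE] := nt_colift pis kerp.
have kh : nt_comp k h = nt_id C.
  apply: uniq; apply: nt_eq => x u; rewrite !ntcompE.
  have := kE x u; rewrite -hp ntcompE; exact.
split=> x v.
  have [u uE] := pis x (h x v); exists u.
  by rewrite -kE uE -ntcompE kh ntidE.
split=> [pv|[u <-]]; last exact: pf.
by apply/pie; rewrite -hp ntcompE pv lfun0.
Qed.

(** The kernel of a finite free cover is again finitely determined, for the larger list [S ++ r],
    and so has a finite free cover itself. *)
Lemma fdet_tame S X : fdet S X -> is_tame X.
Proof.
move=> SX; have [r [q qs]] := fdet_generated SX.
have [Z [i [ii ie]]] := kernel_exists q.
have SZ : fdet (S ++ r) Z.
  apply: (fdet_kernel ii ie).
    by apply: fdetW (@fdet_free _ P K r) => p; rewrite mem_cat orbC => ->.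
  by apply: fdetW SX => p; rewrite mem_cat => ->.
have [s [e es]] := fdet_generated SZ.
exists s, r, (nt_comp i e), q; split.
  apply: nt_eq => x u; rewrite /= !comp_lfunE zero_lfunE.
  by apply/ie; eexists.
move=> B g g0; have ker x u : q x u = 0 -> g x u = 0.
  move=> /ie [v <-]; have [w <-] := es x v.
  have /(congr1 (fun k : nattrans _ _ => k x w)) := g0.
  by rewrite /= !comp_lfunE zero_lfunE.
have [h hE] := nt_colift qs ker.
exists h; split; first by apply: nt_eq => x u; rewrite ntcompE.
move=> h' h'E; apply: nt_eq => x v; have [u <-] := qs x v.
by rewrite hE -h'E ntcompE.
Qed.

Lemma tame_fdet X : is_tame X -> exists S, fdet S X.
Proof.
move=> [s [r [phi [q [q0 qu]]]]].
have [Q [pi [pis pie]]] := cokernel_exists phi.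
have qphi x u : q x (phi x u) = 0.
  have := congr1 (fun k : nattrans (free K s) X => k x u) q0.
  by rewrite /= comp_lfunE zero_lfunE.
have piq : exists h : nattrans X Q, nt_comp h q = pi.
  have [|h [hE _]] := qu Q pi; last by exists h.
  by apply: nt_eq => x u; rewrite ntcompE [RHS]ntzeroE; apply/pie; exists u.
have idq (k : nattrans X X) : nt_comp k q = q -> k = nt_id X.
  have [|h [_ hu]] := qu X q; first exact: q0.
  move=> kq; rewrite -(hu k kq); apply: hu.
  by apply: nt_eq => x u; rewrite ntcompE ntidE.
have [qs qe] := universal_cokernel_pointwise qphi pis pie piq idq.
exists (s ++ r); apply: (fdet_cokernel qs qe).
  by apply: fdetW (@fdet_free _ P K s) => p; rewrite mem_cat => ->.
by apply: fdetW (@fdet_free _ P K r) => p; rewrite mem_cat orbC => ->.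
Qed.

Lemma tame_common2 X Y : is_tame X -> is_tame Y ->
  exists S, fdet S X /\ fdet S Y.
Proof.
move=> /tame_fdet [S SX] /tame_fdet [T TY]; exists (S ++ T); split.
  by apply: fdetW SX => p; rewrite mem_cat => ->.
by apply: fdetW TY => p; rewrite mem_cat orbC => ->.
Qed.

Lemma tame_dirsum X Y : is_tame X -> is_tame Y -> is_tame (dirsum X Y).
Proof.
move=> tX tY; have [S [SX SY]] := tame_common2 tX tY.
exact: fdet_tame (fdet_dirsum SX SY).
Qed.

Lemma tame_kernel_exists (X Y : tame P K) (f : nattrans X Y) :
  exists (A : tame P K) (i : nattrans A X), ninj i /\ nexact i f.
Proof.
have [S [SX SY]] := tame_common2 (tameP X) (tameP Y).
have [A [i [ii ie]]] := kernel_exists f.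
by exists (Tame (fdet_tame (fdet_kernel ii ie SX SY))), i.
Qed.

Lemma tame_cokernel_exists (X Y : tame P K) (f : nattrans X Y) :
  exists (C : tame P K) (p : nattrans Y C), nsurj p /\ nexact f p.
Proof.
have [S [SX SY]] := tame_common2 (tameP X) (tameP Y).
have [C [p [ps pe]]] := cokernel_exists f.
by exists (Tame (fdet_tame (fdet_cokernel ps pe SX SY))), p.
Qed.

(** The image is taken as the kernel of the cokernel, which keeps it tame. *)
Lemma tame_image_exists (X Y : tame P K) (f : nattrans X Y) :
  exists (I : tame P K) (e : nattrans X I) (m : nattrans I Y),
    [/\ nsurj e, ninj m & forall x u, m x (e x u) = f x u].
Proof.
have [C [p [ps pe]]] := tame_cokernel_exists f.
have [I [m [mi me]]] := tame_kernel_exists p.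
have [|e eE] := @nt_lift _ _ _ _ _ _ m f mi.
  by move=> x b; apply/me/pe; exists b.
exists I, e, m; split=> // x v.
have [u uE] := (pe x (m x v)).1 ((me x (m x v)).2 (ex_intro _ v erefl)).
by exists u; apply: (ninjP mi); rewrite eE.
Qed.

End Tameness.

(** * Exactness in the category of tame functors *)

Section TameCategory.
Variables (disp : Order.disp_t) (P : joinSemilatticeType disp) (K : fieldType).
Variables (bt : P).
Hypothesis btP : forall x, (bt <= x)%O.
Local Notation M := (tame_cat P K).
Local Notation "X ~> Y" := (@hom M X Y) (at level 60).
Implicit Types X Y Z A B C : tame P K.

Lemma tcompE X Y Z (g : Y ~> Z) (f : X ~> Y) x u : (g \c f) x u = g x (f x u).
Proof. exact: ntcompE. Qed.

Lemma tidE X x u : (@idm M X : X ~> X) x u = u.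
Proof. exact: ntidE. Qed.

Lemma tzeroE X Y x u : (@zerom M X Y : X ~> Y) x u = 0.
Proof. exact: ntzeroE. Qed.

Lemma hom_eq X Y (f g : X ~> Y) : (forall x u, f x u = g x u) -> f = g.
Proof. exact: nt_eq. Qed.

Lemma hom_eqE X Y (f g : X ~> Y) : f = g -> forall x u, f x u = g x u.
Proof. by move=> ->. Qed.

Lemma ninj_mono X Y (f : X ~> Y) : ninj f -> is_mono f.
Proof.
move=> fi A g h gh; apply: hom_eq => x u; apply: (ninjP fi).
by rewrite -!tcompE gh.
Qed.

(** By Yoneda, an element killed by [f] is a morphism from the tame functor [K(x,-)] that [f] sends
    to zero. *)
Lemma mono_ninj X Y (f : X ~> Y) : is_mono f -> ninj f.
Proof.
move=> fm x u fu; have [g gE] := yoneda u.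
suff g0 : (g : Ktame K (Some x) ~> X) = zerom _ _ by rewrite -gE g0 (@tzeroE (Ktame K (Some x))).
apply: fm; apply: hom_eq => y v; rewrite !tcompE tzeroE lfun0.
have [xy|xy] := boolP (x <= y)%O; last first.
  by rewrite (Kfun_notin v xy) !lfun0.
have [a ->] := Kgen_span v.
by rewrite !lfunZ (nt_gen_fmap xy) gE ntnatE fu lfun0 scaler0.
Qed.

Lemma nsurj_epi X Y (f : X ~> Y) : nsurj f -> is_epi f.
Proof.
move=> fs A g h gh; apply: hom_eq => x v; have [u <-] := fs x v.
by rewrite -!tcompE gh.
Qed.

Lemma epi_nsurj X Y (f : X ~> Y) : is_epi f -> nsurj f.
Proof.
move=> fe; have [C [p [ps pe]]] := tame_cokernel_exists btP f.
have p0 : (p : Y ~> C) = zerom _ _.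
  by apply: fe; apply: hom_eq => x u; rewrite !tcompE tzeroE; apply/pe; exists u.
by move=> x v; apply/pe; rewrite p0 tzeroE.
Qed.

Lemma iso_bij X Y (f : X ~> Y) : is_iso f -> ninj f /\ nsurj f.
Proof.
move=> [g [gf fg]]; split=> [x u fu|x v].
  by rewrite -(tidE u) -gf tcompE fu lfun0.
by exists (g x v); rewrite -tcompE fg tidE.
Qed.

Lemma bij_iso X Y (f : X ~> Y) : ninj f -> nsurj f -> is_iso f.
Proof.
move=> fi fs; have [g [gf fg]] := nt_inverse fi fs.
by exists (g : Y ~> X); split; apply: hom_eq => x u; rewrite tcompE tidE.
Qed.

Lemma kernel_pointwise X Y (f : X ~> Y) A (i : A ~> X) :
  is_kernel f i -> ninj i /\ nexact i f.
Proof.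
move=> [fi0 iu]; split.
  apply: mono_ninj => B g h gh.
  have [|k [_ ku]] := iu B (i \c h); first by rewrite compA fi0 comp0m.
  by rewrite -(ku g gh) -(ku h erefl).
move=> x v; split=> [fv|[u <-]]; last by rewrite -tcompE fi0 tzeroE.
have [g gE] := yoneda v.
have [|h [hE _]] := iu (Ktame K (Some x)) (g : Ktame K (Some x) ~> X).
  apply: hom_eq => y w; rewrite !tcompE tzeroE.
  have [xy|xy] := boolP (x <= y)%O; last first.
    by rewrite (Kfun_notin w xy) !lfun0.
  have [a ->] := Kgen_span w.
  by rewrite !lfunZ (nt_gen_fmap xy) gE ntnatE fv lfun0 scaler0.
by exists (h x (Kgen K (Some x) x)); rewrite -tcompE hE.
Qed.

Lemma pointwise_kernel X Y (f : X ~> Y) A (i : A ~> X) :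
  ninj i -> nexact i f -> is_kernel f i.
Proof.
move=> ii ie; split=> [|B g fg].
  by apply: hom_eq => x u; rewrite tcompE tzeroE; apply/ie; exists u.
have [|h hE] := @nt_lift _ _ _ _ _ _ i g ii.
  by move=> x b; apply/ie; rewrite -tcompE fg tzeroE.
exists (h : B ~> A); split; first by apply: hom_eq => x u; rewrite tcompE.
by move=> h' h'E; apply: (ninj_mono ii); apply: hom_eq => x u; rewrite h'E tcompE.
Qed.

Lemma pointwise_cokernel X Y (f : X ~> Y) C (p : Y ~> C) :
  nsurj p -> nexact f p -> is_cokernel f p.
Proof.
move=> ps pe; split=> [|B g gf].
  by apply: hom_eq => x u; rewrite tcompE tzeroE; apply/pe; exists u.
have [|h hE] := @nt_colift _ _ _ _ _ _ p g ps.
  by move=> x b /pe [a <-]; rewrite -tcompE gf tzeroE.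
exists (h : C ~> B); split; first by apply: hom_eq => x u; rewrite tcompE.
by move=> h' h'E; apply: (nsurj_epi ps); apply: hom_eq => x u; rewrite h'E tcompE.
Qed.

Lemma cokernel_pointwise X Y (f : X ~> Y) C (p : Y ~> C) :
  is_cokernel f p -> nsurj p /\ nexact f p.
Proof.
move=> [pf pu]; have [Q [pi [pis pie]]] := tame_cokernel_exists btP f.
have pf0 x u : p x (f x u) = 0 by rewrite -tcompE pf tzeroE.
apply: (universal_cokernel_pointwise pf0 pis pie).
  have [|h [hE _]] := pu Q pi; last by exists h.
  by apply: hom_eq => x u; rewrite tcompE tzeroE; apply/pie; exists u.
move=> k kp; have [|h [_ hu]] := pu C p; first exact: pf.
rewrite -(hu k kp); apply: hu.
by apply: hom_eq => x u; rewrite tcompE tidE.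
Qed.

(** Kernels of tame functors exist, so the default value in [ker] is never reached; likewise for
    [coker] below. *)
Lemma ker_inclusion X Y (f : X ~> Y) :
  exists i : ker f ~> X, ninj i /\ nexact i f.
Proof.
rewrite /ker; case: pselect => [e|[]].
  by case: (cid e) => A [i ik] /=; exists i; exact: kernel_pointwise.
have [A [i [ii ie]]] := tame_kernel_exists btP f.
by exists A, i; exact: pointwise_kernel.
Qed.

Lemma coker_projection X Y (f : X ~> Y) :
  exists p : Y ~> coker f, nsurj p /\ nexact f p.
Proof.
rewrite /coker; case: pselect => [e|[]].
  by case: (cid e) => A [i ik] /=; exists i; exact: cokernel_pointwise.
have [A [i [ii ie]]] := tame_cokernel_exists btP f.
by exists A, i; exact: pointwise_cokernel.
Qed.

Definition tdirsum X Y : tame P K := Tame (tame_dirsum btP (tameP X) (tameP Y)).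

Lemma is_coproduct_dirsum X Y (i : X ~> tdirsum X Y) (j : Y ~> tdirsum X Y) :
  (forall x u, i x u = (u, 0)) -> (forall x u, j x u = (0, u)) ->
  is_coproduct i j.
Proof.
move=> iE jE Z p q; have [r rE] := copair_exists p q.
exists (r : tdirsum X Y ~> Z); split.
  by split; apply: hom_eq => x u; rewrite tcompE ?iE ?jE rE /= lfun0 ?addr0 ?add0r.
move=> r' [r'p r'q]; apply: hom_eq => x [u v]; rewrite rE /=.
rewrite -r'p -r'q !tcompE iE jE -lfunD; congr (r' x _).
by congr pair; rewrite ?addr0 ?add0r.
Qed.

(** Direct sums in [direct_sum_max] are given by a universal property only. Its uniqueness part
    makes the map from the concrete sum epi, hence surjective. *)
Lemma coproduct_generates A B S (i : A ~> S) (j : B ~> S) :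
  is_coproduct i j -> forall x s, exists a b, s = i x a + j x b.
Proof.
move=> ij x s; have [r rE] := copair_exists i j.
have [u <-] : exists u, r x u = s; last by rewrite rE; exists u.1, u.2.
apply: (@epi_nsurj (tdirsum A B) S r) => Z g h gh.
have [k [_ ku]] := ij Z (g \c i) (g \c j).
rewrite -(ku g) //; apply: ku; split; apply: hom_eq => y a; rewrite !tcompE.
  have := hom_eqE gh (a, 0).
  by rewrite !tcompE !rE /= lfun0 addr0.
have := hom_eqE gh (0, a).
by rewrite !tcompE !rE /= lfun0 add0r.
Qed.

Lemma coproduct_independent A B S (i : A ~> S) (j : B ~> S) :
  is_coproduct i j ->
  forall x a b, i x a + j x b = 0 -> a = 0 /\ b = 0.
Proof.
move=> ij x a b e.
have [r1 [[r1i r1j] _]] := ij A (@idm M A) (@zerom M B A).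
have [r2 [[r2i r2j] _]] := ij B (@zerom M A B) (@idm M B).
have e1 := congr1 (r1 x) e; have e2 := congr1 (r2 x) e.
move: e1 e2; rewrite !lfunD -!tcompE r1i r1j r2i r2j !tidE !tzeroE !lfun0.
by rewrite addr0 add0r.
Qed.

(** The square is a push-out exactly when [b - g] is the cokernel of [(f, a)] from [X0] to the sum
    of [X1] and [Y0]. *)
Lemma pushout_pointwise X0 X1 Y0 Y1 (f : X0 ~> X1) (g : Y0 ~> Y1)
    (a : X0 ~> Y0) (b : X1 ~> Y1) : is_pushout f g a b ->
  (forall x y, exists u v, y = b x u + g x v) /\
  (forall x u v, b x u = g x v -> exists w, u = f x w /\ v = a x w).
Proof.
move=> [sq un].
have [ng ngE] := opp_exists g.
have [q qE] := copair_exists b ng; have [phi phiE] := pair_exists f a.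
suff [qs qe] : nsurj q /\ nexact phi q.
  split=> [x y|x u v buv].
    by have [u <-] := qs x y; exists u.1, (- u.2); rewrite qE ngE lfunN.
  have [|w] := (qe x (u, v)).1; first by rewrite qE ngE /= buv subrr.
  by rewrite phiE => -[<- <-]; exists w.
apply: (@cokernel_pointwise X0 (tdirsum X1 Y0) phi Y1 q); split.
  apply: hom_eq => x u; rewrite tcompE tzeroE phiE qE /= ngE.
  by rewrite -!tcompE sq subrr.
move=> B h h0; have [i iE] := inl_exists X1 Y0; have [j jE] := inr_exists X1 Y0.
have [nj njE] := opp_exists j.
have [|r [[rb rg] ru]] := un B (h \c (i : X1 ~> tdirsum X1 Y0)) (h \c nj).
  apply: hom_eq => x u; rewrite !tcompE iE njE jE.
  have := hom_eqE h0 u.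
  rewrite tcompE tzeroE phiE => e; apply/eqP; rewrite -subr_eq0 -lfunB -e.
  by apply/eqP; congr (h x _); congr pair; rewrite /= ?oppr0 ?addr0 ?opprK ?add0r.
exists r; split.
  apply: hom_eq => x [u v]; rewrite tcompE qE /= ngE lfunD lfunN -!tcompE rb rg.
  rewrite !tcompE iE njE jE -lfunB; congr (h x _).
  by congr pair; rewrite /= ?oppr0 ?addr0 ?opprK ?add0r.
move=> r' r'q; apply: ru; split; apply: hom_eq => x u; rewrite !tcompE -r'q tcompE qE.
  by rewrite iE /= lfun0 addr0.
by rewrite njE jE /= ngE oppr0 lfun0 add0r !lfunN opprK.
Qed.

(** Dually, [(f, a)] is the kernel of [b - g]. *)
Lemma pullback_pointwise X0 X1 Y0 Y1 (f : X0 ~> X1) (g : Y0 ~> Y1)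
    (a : X0 ~> Y0) (b : X1 ~> Y1) : is_pullback f g a b ->
  (forall x w, f x w = 0 -> a x w = 0 -> w = 0) /\
  (forall x u v, b x u = g x v -> exists w, u = f x w /\ v = a x w).
Proof.
move=> [sq un].
have [ng ngE] := opp_exists g.
have [q qE] := copair_exists b ng; have [phi phiE] := pair_exists f a.
suff [phii phie] : ninj phi /\ nexact phi q.
  split=> [x w fw aw|x u v buv].
    by apply: (phii x); rewrite phiE fw aw.
  have [|w] := (phie x (u, v)).1; first by rewrite qE ngE /= buv subrr.
  by rewrite phiE => -[<- <-]; exists w.
apply: (@kernel_pointwise (tdirsum X1 Y0) Y1 q X0 phi); split.
  apply: hom_eq => x u; rewrite tcompE tzeroE phiE qE /= ngE.
  by rewrite -!tcompE sq subrr.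
move=> B h h0; have [i iE] := fst_exists X1 Y0; have [j jE] := snd_exists X1 Y0.
have [|r [[rb rg] ru]] := un B ((i : tdirsum X1 Y0 ~> X1) \c h)
    ((j : tdirsum X1 Y0 ~> Y0) \c h).
  apply: hom_eq => x u; rewrite !tcompE iE jE.
  have := hom_eqE h0 u.
  by rewrite tcompE tzeroE qE ngE => /eqP; rewrite subr_eq0 => /eqP.
exists r; split.
  apply: hom_eq => x u; rewrite tcompE phiE -!tcompE rb rg !tcompE iE jE.
  by case: (h x u).
move=> r' r'q; apply: ru; split; apply: hom_eq => x u; rewrite !tcompE -r'q tcompE.
  by rewrite iE phiE.
by rewrite jE phiE.
Qed.

End TameCategory.

(** * Homogeneous valuations *)

Section Norms.
Variables (disp : Order.disp_t) (P : joinSemilatticeType disp) (K : fieldType).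
Variables (bt : P).
Hypothesis btP : forall x, (bt <= x)%O.
Local Notation M := (tame_cat P K).
Local Notation "X ~> Y" := (@hom M X Y) (at level 60).
Variables (R : realType) (N : M -> \bar R).
Hypothesis normN : is_norm N.
Implicit Types X Y Z A B C : tame P K.
Local Open Scope ereal_scope.
Local Notation hv := (homogeneous_valuation N).

Lemma norm_ge0 X : 0 <= N X. Proof. by case: normN. Qed.

Lemma norm_zero X : (forall x (u : X x), u = 0%R) -> N X = 0.
Proof.
move=> X0; have [_ N0 _] := normN; apply: N0 => Y.
split=> f; apply: hom_eq => x u; rewrite tzeroE; first exact: X0.
by rewrite (X0 x u) lfun0.
Qed.

Lemma norm_short X Y Z (f : X ~> Y) (g : Y ~> Z) :
  ninj f -> nsurj g -> nexact f g ->
  [/\ N X <= N Y, N Z <= N Y & N Y <= N X + N Z].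
Proof.
move=> fi gs fg; have [_ _ N3] := normN.
have [|le1 le2] := N3 X Y Z f g.
  by split; [exact: (pointwise_kernel fi)|exact: (pointwise_cokernel gs)].
by move: le1; rewrite ge_max => /andP[].
Qed.

Lemma norm_inj X Y (f : X ~> Y) : ninj f -> N X <= N Y.
Proof.
move=> fi; have [C [p [ps pe]]] := tame_cokernel_exists btP f.
by have [] := @norm_short X Y C f p fi ps pe.
Qed.

Lemma norm_surj X Y (f : X ~> Y) : nsurj f -> N Y <= N X.
Proof.
move=> fs; have [A [i [ii ie]]] := tame_kernel_exists btP f.
by have [] := @norm_short A X Y i f ii fs ie.
Qed.

Lemma norm_bij X Y (f : X ~> Y) : ninj f -> nsurj f -> N X = N Y.
Proof. by move=> fi fs; apply/le_anti; rewrite (norm_inj fi) (norm_surj fs). Qed.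

(** The images of [f] and [g] turn this into a short exact sequence; they are a quotient of [X] and
    a subobject of [Z], so their norms are no larger. *)
Lemma norm_exact X Y Z (f : X ~> Y) (g : Y ~> Z) :
  nexact f g -> N Y <= N X + N Z.
Proof.
move=> fg; have [I [e [m [es mi me]]]] := tame_image_exists btP g.
have [J [e' [m' [es' mi' me']]]] := tame_image_exists btP f.
have exact : nexact m' e.
  move=> x v; split=> [ev|[u <-]].
    have /fg [u <-] : g x v = 0%R by rewrite -me ev lfun0.
    by exists (e' x u); rewrite me'.
  apply: (mi x); rewrite me; apply/fg; have [w <-] := es' x u.
  by exists w; rewrite me'.
have [_ _ le] := @norm_short J Y I m' e mi' es exact.
apply: le_trans le _; apply: leeD.
  exact: (@norm_surj X J e').
exact: (@norm_inj I Z m).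
Qed.

(** This and the next three lemmas reduce inequalities between valuations to elements: the
    hypotheses say that [a] or [b] induces a map of kernels or cokernels, and that this map is
    injective or surjective. *)
Lemma norm_ker_inj X0 X1 Y0 Y1 (f : X0 ~> X1) (g : Y0 ~> Y1) (a : X0 ~> Y0) :
  (forall x u, f x u = 0%R -> g x (a x u) = 0%R) ->
  (forall x u, f x u = 0%R -> a x u = 0%R -> u = 0%R) ->
  N (ker f) <= N (ker g).
Proof.
move=> fg ainj; have [i [ii ie]] := ker_inclusion btP f.
have [j [ji je]] := ker_inclusion btP g.
have [|h hE] := @nt_lift _ _ _ _ _ _ j (a \c i) ji.
  by move=> x b; rewrite tcompE; apply/je/fg/ie; exists b.
apply: (@norm_inj _ _ h) => x u hu; apply: (ii x).
apply: ainj; first by apply/ie; exists u.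
by rewrite -tcompE -hE hu lfun0.
Qed.

Lemma norm_ker_surj X0 X1 Y0 Y1 (f : X0 ~> X1) (g : Y0 ~> Y1) (a : X0 ~> Y0) :
  (forall x u, f x u = 0%R -> g x (a x u) = 0%R) ->
  (forall x v, g x v = 0%R -> exists2 u, f x u = 0%R & a x u = v) ->
  N (ker g) <= N (ker f).
Proof.
move=> fg asurj; have [i [ii ie]] := ker_inclusion btP f.
have [j [ji je]] := ker_inclusion btP g.
have [|h hE] := @nt_lift _ _ _ _ _ _ j (a \c i) ji.
  by move=> x b; rewrite tcompE; apply/je/fg/ie; exists b.
apply: (@norm_surj _ _ h) => x v.
have [|u fu au] := asurj x (j x v); first by apply/je; exists v.
have /ie [w wE] := fu; exists w; apply: (ninjP ji).
by rewrite hE tcompE wE.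
Qed.

Lemma norm_coker_inj X0 X1 Y0 Y1 (f : X0 ~> X1) (g : Y0 ~> Y1) (b : X1 ~> Y1) :
  (forall x u, exists v, b x (f x u) = g x v) ->
  (forall x u v, b x u = g x v -> exists w, f x w = u) ->
  N (coker f) <= N (coker g).
Proof.
move=> fg binj; have [p [ps pe]] := coker_projection btP f.
have [q [qs qe]] := coker_projection btP g.
have [|h hE] := @nt_colift _ _ _ _ _ _ p (q \c b) ps.
  move=> x v /pe [u <-]; rewrite tcompE; apply/qe.
  by have [w ->] := fg x u; exists w.
apply: (@norm_inj _ _ h) => x c; have [u <-] := ps x c.
by rewrite hE tcompE => /qe [v /esym/binj [w <-]]; apply/pe; exists w.
Qed.

Lemma norm_coker_surj X0 X1 Y0 Y1 (f : X0 ~> X1) (g : Y0 ~> Y1) (b : X1 ~> Y1) :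
  (forall x u, exists v, b x (f x u) = g x v) ->
  (forall x y, exists u v, y = (b x u + g x v)%R) ->
  N (coker g) <= N (coker f).
Proof.
move=> fg bsurj; have [p [ps pe]] := coker_projection btP f.
have [q [qs qe]] := coker_projection btP g.
have [|h hE] := @nt_colift _ _ _ _ _ _ p (q \c b) ps.
  move=> x v /pe [u <-]; rewrite tcompE; apply/qe.
  by have [w ->] := fg x u; exists w.
apply: (@norm_surj _ _ h) => x c; have [y <-] := qs x c.
have [u [v ->]] := bsurj x y; exists (p x u); rewrite hE tcompE lfunD.
by rewrite [X in _ = (_ + X)%R](_ : _ = 0%R) ?addr0 //; apply/qe; exists v.
Qed.

Lemma norm_ker_ninj X Y (f : X ~> Y) : ninj f -> N (ker f) = 0.
Proof.
move=> fi; apply: norm_zero => x u; have [i [ii ie]] := ker_inclusion btP f.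
by apply: (ii x); apply: (fi x); apply/ie; exists u.
Qed.

Lemma norm_coker_nsurj X Y (f : X ~> Y) : nsurj f -> N (coker f) = 0.
Proof.
move=> fs; apply: norm_zero => x u; have [p [ps pe]] := coker_projection btP f.
by have [v <-] := ps x u; apply/pe.
Qed.

Lemma hv_ninj X Y (f : X ~> Y) : ninj f -> hv f = N (coker f).
Proof. by move=> fi; rewrite /homogeneous_valuation norm_ker_ninj // add0e. Qed.

Lemma norm_coker_cokernel X Y (f : X ~> Y) C (p : Y ~> C) :
  nsurj p -> nexact f p -> N (coker f) = N C.
Proof.
move=> ps pe; have [q [qs qe]] := coker_projection btP f.
have [|h hE] := @nt_colift _ _ _ _ _ _ q p qs.
  by move=> x u /qe /pe.
apply: (@norm_bij _ _ h) => x c.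
  by have [u <-] := qs x c; rewrite hE => /pe /qe.
by have [u <-] := ps x c; exists (q x u); rewrite hE.
Qed.

Lemma norm_ker_zerom X Y : N (ker (@zerom M X Y)) = N X.
Proof.
have [i [ii ie]] := ker_inclusion btP (@zerom M X Y).
by apply: (@norm_bij _ _ i) => // x u; apply/ie; rewrite tzeroE.
Qed.

Lemma norm_coker_zerom X Y : N (coker (@zerom M X Y)) = N Y.
Proof.
have [p [ps pe]] := coker_projection btP (@zerom M X Y).
by symmetry; apply: (@norm_bij _ _ p) => // x u /pe [v <-]; rewrite tzeroE.
Qed.

Lemma hv_valuation : is_valuation hv.
Proof.
split=> [X Y f|X Y f /iso_bij [fi fs]|X Y].
- by apply: adde_ge0; exact: norm_ge0.
- by rewrite hv_ninj // norm_coker_nsurj.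
- by rewrite /homogeneous_valuation !norm_ker_zerom !norm_coker_zerom addeC.
Qed.

Lemma hv_pushout_nonexpansive : pushout_nonexpansive hv.
Proof.
move=> X0 X1 Y0 Y1 f g a b po; have [sq _] := po.
have [gen rel] := pushout_pointwise btP po; apply: leeD.
  apply: (norm_ker_surj (a := a)) => x u fu.
    by rewrite -tcompE -sq tcompE fu lfun0.
  by have [|w [w1 w2]] := rel x 0%R u; [rewrite lfun0|exists w].
apply: (norm_coker_surj (b := b)) => x u; last exact: gen.
by exists (a x u); rewrite -!tcompE sq.
Qed.

Lemma hv_pullback_nonexpansive : pullback_nonexpansive hv.
Proof.
move=> X0 X1 Y0 Y1 f g a b pb; have [sq _] := pb.
have [inj rel] := pullback_pointwise btP pb; apply: leeD.
  apply: (norm_ker_inj (a := a)) => x u fu; last exact: inj.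
  by rewrite -tcompE -sq tcompE fu lfun0.
apply: (norm_coker_inj (b := b)) => x u.
  by exists (a x u); rewrite -!tcompE sq.
by move=> v /rel [w [-> _]]; exists w.
Qed.

(** From the exact sequence [ker f -> ker (g \c f) -> ker g]; the cokernels below form a similar
    one. *)
Lemma norm_ker_comp X Y Z (f : X ~> Y) (g : Y ~> Z) :
  N (ker (g \c f)) <= N (ker f) + N (ker g).
Proof.
have [i [ii ie]] := ker_inclusion btP f; have [j [ji je]] := ker_inclusion btP g.
have [k [ki ke]] := ker_inclusion btP (g \c f).
have [|a aE] := @nt_lift _ _ _ _ _ _ k i ki.
  by move=> x u; apply/ke; rewrite tcompE (ie x _).2 ?lfun0 //; exists u.
have [|b bE] := @nt_lift _ _ _ _ _ _ j (f \c k) ji.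
  by move=> x u; apply/je; rewrite tcompE -tcompE; apply/ke; exists u.
apply: (@norm_exact _ _ _ a b) => x v; split=> [bv|[u <-]].
  have /ie [u uE] : f x (k x v) = 0%R by rewrite -tcompE -bE bv lfun0.
  by exists u; apply: (ninjP ki); rewrite aE.
by apply: (ji x); rewrite bE tcompE aE; apply/ie; exists u.
Qed.

Lemma norm_coker_comp X Y Z (f : X ~> Y) (g : Y ~> Z) :
  N (coker (g \c f)) <= N (coker f) + N (coker g).
Proof.
have [p [ps pe]] := coker_projection btP f; have [q [qs qe]] := coker_projection btP g.
have [r [rs re]] := coker_projection btP (g \c f).
have [|a aE] := @nt_colift _ _ _ _ _ _ p (r \c g) ps.
  by move=> x u /pe [v <-]; rewrite tcompE; apply/re; exists v; rewrite tcompE.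
have [|b bE] := @nt_colift _ _ _ _ _ _ r q rs.
  by move=> x u /re [v <-]; apply/qe; rewrite tcompE; exists (f x v).
apply: (@norm_exact _ _ _ a b) => x v; split=> [|[u <-]].
  have [z <-] := rs x v; rewrite bE => /qe [y <-].
  by exists (p x y); rewrite aE tcompE.
have [y <-] := ps x u; rewrite aE tcompE bE; apply/qe; by exists y.
Qed.

Lemma hv_comp_subadditive : comp_subadditive hv.
Proof.
move=> X Y Z g f; rewrite /homogeneous_valuation.
by rewrite addeACA; apply: leeD; [exact: norm_ker_comp|exact: norm_coker_comp].
Qed.

(** [kf] and [cg] hold for all composites. If [f] is epi, its cokernel is zero and [ker (g \c f)]
    maps onto [ker g]; if [g] is mono, its kernel is zero and [coker f] embeds in
    [coker (g \c f)]. *)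
Lemma hv_monotone : monotone_valuation hv.
Proof.
move=> X Y Z g f fg.
have kf : N (ker f) <= N (ker (g \c f)).
  apply: (norm_ker_inj (a := @idm M X)) => x u fu; last by rewrite tidE.
  by rewrite tidE tcompE fu lfun0.
have cg : N (coker g) <= N (coker (g \c f)).
  apply: (norm_coker_surj (b := @idm M Z)) => x u.
    by exists (f x u); rewrite tidE tcompE.
  by exists u, 0%R; rewrite tidE lfun0 addr0.
rewrite ge_max; case: fg => [/(epi_nsurj btP) fs|/mono_ninj gi].
  apply/andP; split.
    rewrite /homogeneous_valuation norm_coker_nsurj // adde0.
    by apply: le_trans kf _; rewrite leeDl // norm_ge0.
  apply: leeD => //; apply: (norm_ker_surj (a := f)) => x u.
    by rewrite tcompE.
  by have [w <-] := fs x u; exists w; rewrite ?tcompE.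
apply/andP; split; last first.
  rewrite hv_ninj //; apply: le_trans cg _.
  by rewrite leeDr // norm_ge0.
apply: leeD => //; apply: (norm_coker_inj (b := g)) => x u.
  by exists u; rewrite tcompE.
by move=> v; rewrite tcompE => /(ninjP gi) ->; exists v.
Qed.

End Norms.

(** * Minimal subobjects and numbers of generators *)

Section Shifts.
Variables (disp : Order.disp_t) (P : joinSemilatticeType disp) (K : fieldType).
Variables (bt : P).
Hypothesis btP : forall x, (bt <= x)%O.
Local Notation M := (tame_cat P K).
Local Notation "X ~> Y" := (@hom M X Y) (at level 60).
Variables (R : realType) (N : M -> \bar R).
Hypothesis normN : is_norm N.
Implicit Types (X Y Z A B C : tame P K) (t : {nonneg R}).
Local Open Scope ereal_scope.
Local Notation hv := (homogeneous_valuation N).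

(** Minimality depends only on the image; this trades an abstract shift for an explicit inclusion
    [Kincl]. *)
Lemma t_minimal_image t A B X (f : A ~> X) (g : B ~> X) :
  t_minimal hv t f -> ninj g ->
  (forall x a, exists b, g x b = f x a) ->
  (forall x b, exists a, f x a = g x b) -> t_minimal hv t g.
Proof.
move=> [/mono_ninj fi ft fmin] gi fg gf; have [e eE] := nt_lift fi gf.
have ei : ninj e by move=> x b eb; apply: (gi x); rewrite -eE eb lfun0.
split; first exact: ninj_mono.
  rewrite (hv_ninj btP normN) //; have [p [ps pe]] := coker_projection btP f.
  rewrite (norm_coker_cokernel btP normN ps) -?(hv_ninj btP normN) //.
  move=> x v; rewrite pe; split=> -[u <-].
    by have [b <-] := fg x u; exists b.
  by have [a <-] := gf x u; exists a.
move=> C k km kt h gh.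
have [hi hs] : ninj (nt_comp e h) /\ nsurj (nt_comp e h).
  apply: (@iso_bij _ P K C A); apply: (fmin C k km kt).
  by apply: hom_eq => x u; rewrite tcompE ntcompE eE -gh tcompE.
apply: bij_iso => x u; first by move=> hu; apply: (hi x); rewrite ntcompE hu lfun0.
have [v vE] := hs x (e x u); exists v; apply: (ninjP ei).
by rewrite -vE ntcompE.
Qed.

(** [A] and [B] are compared through [A :&: B], the pullback of
  [f (+) g] along the diagonal of [X]. *)
Lemma t_minimal_smallest t A B X (f : A ~> X) (g : B ~> X) :
  direct_sum_max hv -> t_minimal hv t f -> ninj g -> hv g <= t%:num%:E ->
  exists k : A ~> B, forall x a, g x (k x a) = f x a.
Proof.
move=> sum_max [fm ft fmin] gi gt; have fi := mono_ninj fm.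
have [d dE] := prod_exists f g.
have [ng ngE] := opp_exists g.
have [r rE] := copair_exists f ng.
have [C [phi [phii phie]]] := @tame_kernel_exists _ P K bt btP (tdirsum btP A B) X r.
have fgphi x u : f x (phi x u).1 = g x (phi x u).2.
  have /eqP := (phie x (phi x u)).2 (ex_intro _ u erefl).
  by rewrite rE ngE subr_eq0 => /eqP.
have [p1 p1E] := fst_exists A B; have [p2 p2E] := snd_exists A B.
pose k1 : C ~> A := nt_comp p1 phi; pose k2 : C ~> B := nt_comp p2 phi.
have k1E x u : k1 x u = (phi x u).1 by rewrite ntcompE p1E.
have k2E x u : k2 x u = (phi x u).2 by rewrite ntcompE p2E.
have mi : ninj (f \c k1).
  move=> x u; rewrite tcompE k1E => /fi u1; apply: (phii x).
  move: (fgphi x u); rewrite u1 lfun0 => /esym/gi u2.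
  by case: (phi x u) u1 u2 => ? ? /= -> ->.
have di : ninj (d : tdirsum btP A B ~> tdirsum btP X X).
  by move=> x [u v]; rewrite dE /= => -[/fi -> /gi ->].
have dt : hv (d : tdirsum btP A B ~> tdirsum btP X X) <= t%:num%:E.
  apply: (@le_trans _ _ (maxe (hv f) (hv g))); last by rewrite ge_max ft gt.
  apply: sum_max => //; first exact: ninj_mono.
  have [i1 i1E] := inl_exists A B; have [i2 i2E] := inr_exists A B.
  have [j1 j1E] := inl_exists X X; have [j2 j2E] := inr_exists X X.
  exists i1, i2, j1, j2; split; try exact: is_coproduct_dirsum.
    by apply: hom_eq => x u; rewrite !tcompE i1E j1E dE /= lfun0.
  by apply: hom_eq => x u; rewrite !tcompE i2E j2E dE /= lfun0.
have mt : hv (f \c k1) <= t%:num%:E.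
  rewrite (hv_ninj btP normN) //; apply: le_trans dt; rewrite (hv_ninj btP normN) //.
  (* The diagonal embeds the quotient of [X] by the intersection in the sum of the quotients by [A]
     and by [B]. *)
  have [D DE] := pair_exists (nt_id X) (nt_id X).
  apply: (@norm_coker_inj _ P K bt btP _ _ normN _ _ _ _ _ _ (D : X ~> tdirsum btP X X)).
    by move=> x u; exists (phi x u); rewrite DE ntidE dE tcompE k1E fgphi.
  move=> x u v; rewrite DE ntidE dE => -[u1 u2].
  have [|w wE] := (phie x v).1; first by rewrite rE ngE -u1 -u2 subrr.
  by exists w; rewrite tcompE k1E wE -u1.
(* Minimality of [f] makes [k1] invertible: the intersection is all of [A]. *)
have [h [hk kh]] := fmin C _ (ninj_mono mi) mt k1 erefl.
exists (k2 \c h) => x a; rewrite tcompE k2E -fgphi -k1E.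
by have := hom_eqE kh a; rewrite tcompE tidE => ->.
Qed.

Lemma smallest_t_minimal t A X (f : A ~> X) : ninj f -> hv f <= t%:num%:E ->
  (forall B (g : B ~> X), ninj g -> hv g <= t%:num%:E ->
    forall x a, exists b, g x b = f x a) -> t_minimal hv t f.
Proof.
move=> fi ft small; split=> //; first exact: ninj_mono.
move=> B g /mono_ninj gi gt h fh; apply: bij_iso => x u.
  by move=> hu; apply: (gi x); rewrite -fh tcompE hu lfun0.
have [b bE] := small B g gi gt x u; exists b; apply: (ninjP fi).
by rewrite -bE -fh tcompE.
Qed.

(** Epimorphisms in [generated_by] are tested against all functors, so the cokernel is needed there
    and not among tame functors. *)
Lemma generated_byP (X : functor P K) n :
  generated_by X n <-> exists s (q : nattrans (free K s) X), size s = n /\ nsurj q.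
Proof.
split=> -[s [q [sn qe]]]; exists s, q; split=> //.
  have [C [p [ps pe]]] := cokernel_exists q.
  have p0 : p = nt_zero X C.
    apply: qe; apply: nt_eq => x u; rewrite ntcompE /= comp_lfunE zero_lfunE.
    by apply/pe; exists u.
  by move=> x v; apply/pe; rewrite p0 ntzeroE.
move=> A g h gh; apply: nt_eq => x v; have [u <-] := qe x v.
have := congr1 (fun k : nattrans (free K s) A => k x u) gh.
by rewrite /= !comp_lfunE.
Qed.

Lemma beta0_generated X : generated_by X (beta0 X).
Proof. by rewrite /beta0; case: ex_minnP => n /asboolP. Qed.

Lemma beta0_le X s (q : nattrans (free K s) X) : nsurj q ->
  (beta0 X <= size s)%N.
Proof.
move=> qs; rewrite /beta0; case: ex_minnP => n _; apply.
by apply/asboolP/generated_byP; exists s, q.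
Qed.

Lemma beta0_nsurj X Y (f : X ~> Y) : nsurj f -> (beta0 Y <= beta0 X)%N.
Proof.
move=> fs; have /generated_byP [s [q [<- qs]]] := beta0_generated X.
apply: (@beta0_le _ s (nt_comp f q)) => x v.
have [u <-] := fs x v; have [w <-] := qs x u.
by exists w; rewrite ntcompE.
Qed.

End Shifts.

(** * Shifted free functors *)

Section ShiftOfFree.
Variables (disp : Order.disp_t) (P : porderType disp) (K : fieldType).
Implicit Types (X Y Z : functor P K) (s : seq P).

(** Unlike [free], this allows generators at infinity, where a shift may send them; such summands
    are zero. *)
Definition kfree (s : seq (option P)) : functor P K :=
  foldr (fun v => dirsum (Kfun K v)) (Kfun K None) s.

Lemma kfree_generated (s : seq (option P)) :
  exists s' (q : nattrans (free K s') (kfree s)),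
    (size s' <= size s)%N /\ nsurj q.
Proof.
elim: s => [|v s [s' [q [ss' qs]]]] /=.
  by exists [::], (nt_id _); split=> // x u; exists u; rewrite ntidE.
case: v => [v|]; last first.
  have [i iE] := inr_exists (Kfun K (@None P)) (kfree s).
  exists s', (nt_comp i q); split; first exact: leqW.
  move=> x [u v]; have [w wE] := qs x v; exists w.
  by rewrite ntcompE iE wE (Kfun_notin u).
have [r rE] := prod_exists (nt_id (Kfun K (Some v))) q.
exists (v :: s'), r; split=> // x [u w]; have [b bE] := qs x w.
by exists (u, b); rewrite rE ntidE bE.
Qed.

Variable sh : P -> option P.
Hypothesis shP : forall v, leoo (Some v) (sh v).

Fixpoint shift_incl s : nattrans (kfree (map sh s)) (free K s) :=
  match s with
  | [::] => nt_id _
  | v :: s' => sval (cid (prod_exists (Kincl K (shP v)) (shift_incl s')))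
  end.

Lemma shift_inclE v s x u :
  shift_incl (v :: s) x u = (Kincl K (shP v) x u.1, shift_incl s x u.2).
Proof. exact: (svalP (cid (prod_exists (Kincl K (shP v)) (shift_incl s)))). Qed.

Lemma shift_incl_ninj s : ninj (shift_incl s).
Proof.
elim: s => [|v s IH] x; first by move=> u; rewrite ntidE.
move=> [u w]; rewrite shift_inclE => e.
have u0 : u = 0 by exact: (Kincl_ninj (congr1 fst e)).
have w0 : w = 0 by exact: (IH _ _ (congr1 snd e)).
by rewrite u0 w0.
Qed.

(** Only the summands with [p <= v] are nonzero at [v], and monotonicity puts [sh p] below
    [sh v = w] for these. *)
Lemma shift_incl_contains s : {homo sh : v w / (v <= w)%O >-> leoo v w} ->
  forall v w (h : (v <= w)%O), sh v = Some w ->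
  forall a, exists b, shift_incl s w b = fmap (free K s) h a.
Proof.
move=> shh v w h vw; elim: s => [|p s IH] a.
  by exists (fmap (Kfun K None) h a); rewrite ntidE.
case: a => a1 a2; have [b bE] := IH a2.
suff [b1 b1E] : exists b1, Kincl K (shP p) w b1 = fmap (Kfun K (Some p)) h a1.
  by exists (b1, b); rewrite shift_inclE dirsum_fmapE /= bE b1E.
have [pv|pv] := boolP (p <= v)%O.
  by apply: Kincl_surj; rewrite -vw; exact: shh.
by exists 0; rewrite (Kfun_notin a1 pv) !lfun0.
Qed.

(** The summand [K(sh v,-)] is generated by the image of the generator at [v] under the map from [v]
    to [sh v], so it is enough that the image of [g] contains that one element. *)
Lemma shift_incl_least s X B (q : nattrans (free K s) X) (g : nattrans B X) :
  (forall v w (h : (v <= w)%O), sh v = Some w ->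
    forall u, exists b, g w b = fmap X h u) ->
  forall x a, exists b, g x b = q x (shift_incl s x a).
Proof.
move=> gsh; elim: s q => [|v s IH] q x a.
  by exists 0; rewrite (Kfun_notin a) // !lfun0.
have [i iE] := inl_exists (Kfun K (Some v)) (free K s).
have [j jE] := inr_exists (Kfun K (Some v)) (free K s).
case: a => a1 a2; have [b2 b2E] := IH (nt_comp q j) x a2.
suff [b1 b1E] : exists b, g x b = q x (i x (Kincl K (shP v) x a1)).
  exists (b1 + b2); rewrite lfunD b1E b2E ntcompE -lfunD shift_inclE iE jE.
  by congr (q x _); congr pair; rewrite /= ?addr0 ?add0r.
have [vx|vx] := boolP (leoo (sh v) (Some x)); last first.
  by exists 0; rewrite (Kfun_notin a1 vx) !lfun0.
case shv : (sh v) => [w|] in vx; last by [].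
have vw : (v <= w)%O by have := shP v; rewrite shv.
have [b bE] := gsh v w vw shv (q v (i v (Kgen K (Some v) v))).
have [c ->] := Kgen_span a1.
exists (c *: fmap B vx b).
rewrite !lfunZ ntnatE bE; congr (_ *: _).
rewrite Kgen_incl; last by rewrite shv.
rewrite -!ntnatE (fmapME vw vx (le_trans vw vx)); congr (q x (i x _)).
by rewrite Kgen_fmap /=.
Qed.

End ShiftOfFree.

Lemma tame_kfree (disp : Order.disp_t) (P : joinSemilatticeType disp)
    (K : fieldType) (bt : P) (btP : forall x, (bt <= x)%O) (l : seq (option P)) :
  is_tame (kfree K l).
Proof.
elim: l => [|v l IH]; first exact: Kfun_tame.
exact: (tame_dirsum btP (Kfun_tame K v) IH).
Qed.

(** * From contours to norms *)

Section ContourNorm.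
Variables (disp : Order.disp_t) (P : joinSemilatticeType disp) (K : fieldType).
Variables (bt : P).
Hypothesis btP : forall x, (bt <= x)%O.
Local Notation M := (tame_cat P K).
Local Notation "X ~> Y" := (@hom M X Y) (at level 60).
Variables (R : realType) (c : option P -> {nonneg R} -> option P).
Hypothesis cc : is_contour c.
Implicit Types (X Y Z A B C : tame P K) (s t : {nonneg R}).
Local Open Scope ereal_scope.
Local Notation cn := (contour_norm c : M -> \bar R).
Local Notation hv := (homogeneous_valuation cn).

Lemma leoo_refl (v : option P) : leoo v v. Proof. by case: v => /=. Qed.

Lemma contour_le v t : leoo v (c v t). Proof. by case: cc. Qed.

Lemma contour_homo v w s t : leoo v w -> (s <= t)%R -> leoo (c v s) (c w t).
Proof. by case: cc => _ + _ _; apply. Qed.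

Lemma contour_None t : c None t = None.
Proof. by have := contour_le None t; case: (c None t). Qed.

Definition contour_vanishing t (X : functor P K) :=
  forall v w (h : (v <= w)%O), c (Some v) t = Some w -> forall u, fmap X h u = 0%R.

Lemma contour_vanishing_mono s t (X : functor P K) : (s <= t)%R ->
  contour_vanishing s X -> contour_vanishing t X.
Proof.
move=> st Xs v w h vw u.
have := @contour_homo (Some v) (Some v) s t (lexx v) st; rewrite vw.
have := contour_le (Some v) s.
case vs : (c (Some v) s) => [w'|] //= vw' w'w.
by rewrite -(fmapME vw' w'w h) (Xs v w' vw' vs) lfun0.
Qed.

(** Right continuity, from axiom (4) applied to each [p] in [L]. *)
Lemma contour_right_continuous v t (L : seq (option P)) :
  exists2 s, (t < s)%R & forall p, p \in L -> leoo p (c v s) -> leoo p (c v t).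
Proof.
have [_ _ _ c4] := cc; elim: L => [|p L [s ts sL]].
  by exists (t%:num + 1)%:nng%R; [rewrite -num_lt /= ltrDl|].
have [never|[a aP]] := c4 v p.
  exists s => // q; rewrite inE => /orP[/eqP ->|/sL //].
  by rewrite (negPf (never s)).
have [at'|ta] := leP a t.
  by exists s => // q; rewrite inE => /orP[/eqP -> _|/sL //]; rewrite aP.
(* The midpoint [m] exceeds [t], but [c v m] has not yet reached [p]. *)
have m0 : (0 <= (t%:num + a%:num) / 2)%R by [].
pose m : {nonneg R} := NngNum m0.
have tm : (t < m)%R by rewrite -num_lt /= midf_lt.
have ma : (m < a)%R by rewrite -num_lt /= midf_lt.
exists (Order.min s m); first by rewrite lt_min ts tm.
move=> q; rewrite inE => /orP[/eqP ->|qL qs].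
  by rewrite aP leNgt gt_min ma orbT.
apply: (sL q qL); apply: leoo_trans qs _.
by apply: contour_homo; [exact: leoo_refl|rewrite ge_min lexx].
Qed.

Lemma contour_norm_le t X : cn X <= t%:num%:E <-> contour_vanishing t X.
Proof.
split=> [Xt v w h vw u|Xt]; last first.
  apply: ereal_inf_lbound; exists t => // v w h vw.
  by apply/lfunP => u; rewrite Xt // zero_lfunE.
have [S SX] := tame_fdet (tameP X).
(* [None] keeps [v * s] finite; the points of [S] keep [v * t] and [v * s] in one cell, so that the
   map between them is injective. *)
have [s ts sS] := contour_right_continuous (Some v) t (None :: map some S).
have [|_ [s' /= Xs' <-] s's] := @ereal_inf_lt _ _ s%:num%:E (le_lt_trans Xt _).
  by rewrite lte_fin.
have {s' Xs' s's} Xs : contour_vanishing s X.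
  apply: (@contour_vanishing_mono s'); first by rewrite lte_fin in s's; exact: ltW.
  by move=> v' w' h' vw' u'; rewrite (Xs' v' w' h' vw') zero_lfunE.
have := @contour_homo (Some v) (Some v) t s (lexx v) (ltW ts).
case vs : (c (Some v) s) sS => [w'|] sS; last first.
  by have := sS None (mem_head _ _) isT; rewrite vw.
rewrite vw /= => ww'.
have hS p : p \in S -> (p <= w')%O -> (p <= w)%O.
  by move=> pS; have := sS (Some p); rewrite vw; apply; rewrite inE map_f ?orbT.
by apply: (SX w w' ww' hS).1; rewrite (fmapME h ww' (le_trans h ww')) Xs.
Qed.

(** Norm values are compared through their finite upper bounds, which is where [contour_norm_le]
    applies; the value [+oo] costs nothing. *)
Lemma le_nonneg (a b : \bar R) : 0 <= a ->
  (forall t, a <= t%:num%:E -> b <= t%:num%:E) -> b <= a.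
Proof.
case: a => [r|_ _|//]; last by rewrite leey.
by move=> r0 /(_ (NngNum (r0 : (0 <= r)%R))); apply.
Qed.

Lemma contour_norm_ge0 X : 0 <= cn X.
Proof. by apply: le_ereal_inf_tmp => _ [t _ <-]; rewrite lee_fin. Qed.

Lemma contour_norm_is_norm : is_norm cn.
Proof.
split=> [|Z Z0|X Y Z f g [/(kernel_pointwise) [fi fg] /(cokernel_pointwise btP) [gs _]]].
- exact: contour_norm_ge0.
- apply/le_anti; rewrite contour_norm_ge0 andbT.
  apply/(contour_norm_le 0%:nng%R) => v w h _ u.
  have [_ /(_ (@idm M Z)) Zid] := Z0 Z.
  by rewrite -[LHS](tidE (X := Z)) Zid tzeroE.
split.
  rewrite ge_max; apply/andP; split; apply: le_nonneg (contour_norm_ge0 _) _ => t;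
      move=> /contour_norm_le Yt; apply/contour_norm_le => v w h vw u.
    by apply: (fi w); rewrite ntnatE Yt.
  by have [y <-] := gs v u; rewrite -ntnatE Yt // lfun0.
have := contour_norm_le^~ X; have := contour_norm_le^~ Z.
have := contour_norm_ge0 X; have := contour_norm_ge0 Z.
case: (cn X) => [a| |] //; case: (cn Z) => [b| |] // b0 a0 Zb Xa; rewrite ?addey ?addye ?leey //.
pose b' : {nonneg R} := NngNum (b0 : (0 <= b)%R).
pose a' : {nonneg R} := NngNum (a0 : (0 <= a)%R).
have {}Xa := (Xa a').1 (lexx _); have {}Zb := (Zb b').1 (lexx _).
rewrite -EFinD addrC; apply/(contour_norm_le (b'%:num + a'%:num)%:nng%R).
(* After time [b'] the image of [y] in [Z] is zero, so [y] comes from [X], where a further time [a']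
   kills it; axiom (3) bounds the total displacement. *)
move=> v w h vw y; have [_ _ /(_ (Some v) b' a') + _] := cc; rewrite vw.
have := contour_le (Some v) b'; case vb : (c (Some v) b') => [v1|]; last first.
  by rewrite contour_None.
have := contour_le (Some v1) a'; case va : (c (Some v1) a') => [v2|] //= v12 vv1 v2w.
have /fg [x xE] : g v1 (fmap Y vv1 y) = 0%R by rewrite ntnatE Zb.
rewrite -(fmapME vv1 (le_trans v12 v2w) h) -(fmapME v12 v2w (le_trans v12 v2w)).
by rewrite -xE -ntnatE Xa // !lfun0.
Qed.

Let normN := contour_norm_is_norm.

Lemma contour_norm_coker_le t X Y (f : X ~> Y) :
  cn (coker f) <= t%:num%:E <->
  forall v w (h : (v <= w)%O), c (Some v) t = Some w ->
    forall u, exists x, f w x = fmap Y h u.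
Proof.
have [p [ps pe]] := coker_projection btP f; rewrite contour_norm_le.
split=> Yt v w h vw u.
  by apply/pe; rewrite ntnatE Yt.
by have [y <-] := ps v u; rewrite -ntnatE; apply/pe/Yt.
Qed.

Lemma contour_direct_sum_max : direct_sum_max hv.
Proof.
move=> A X B Y f g S T h /mono_ninj fi /mono_ninj gi [i1 [i2 [j1 [j2 [ci cj hi hj]]]]].
have hi' : ninj h.
  move=> x s hs; have [a [b e]] := coproduct_generates btP ci s.
  move: hs; rewrite e lfunD -!tcompE hi hj !tcompE.
  by move=> /(coproduct_independent cj) [/fi -> /gi ->]; rewrite !lfun0 addr0.
rewrite !(hv_ninj btP normN) //.
apply: le_nonneg => [|t]; first by rewrite le_max contour_norm_ge0.
rewrite ge_max => /andP[/contour_norm_coker_le ft /contour_norm_coker_le gt].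
apply/contour_norm_coker_le => v w k vw u.
have [a [b ->]] := coproduct_generates btP cj u.
have [a' a'E] := ft v w k vw a; have [b' b'E] := gt v w k vw b.
exists (i1 w a' + i2 w b')%R.
by rewrite lfunD -!tcompE hi hj !tcompE a'E b'E !ntnatE lfunD.
Qed.

(** The bound on [beta0] is proved together with existence because it is read off this construction,
    a quotient of a shifted free functor; it passes to any other [t]-shift by mutual inclusion. *)
Lemma contour_shift_exists t X : exists A (f : A ~> X),
  t_minimal hv t f /\ (beta0 A <= beta0 X)%N.
Proof.
have /generated_byP [s [q [sX qs]]] := beta0_generated X.
have shP v : leoo (Some v) (c (Some v) t) by exact: contour_le.
pose F : tame P K := Tame (tame_kfree K btP [seq c (Some v) t | v <- s]).
pose phi := nt_comp q (shift_incl K shP s).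
have [A [e [m [es mi me]]]] := @tame_image_exists _ P K bt btP F X phi.
exists A, m; split; last first.
  have [s' [q' [ss' qs']]] := kfree_generated K [seq c (Some v) t | v <- s].
  rewrite -sX; apply: leq_trans (_ : size s' <= _)%N; last by rewrite size_map in ss'.
  apply: (@beta0_le _ _ _ A s' (nt_comp e q')) => x a.
  have [u <-] := es x a; have [w <-] := qs' x u.
  by exists w; rewrite ntcompE.
apply: smallest_t_minimal => //.
  rewrite (hv_ninj btP normN) //; apply/contour_norm_coker_le => v w h vw u.
  have [a <-] := qs v u; rewrite -ntnatE.
  have chomo : {homo (fun v => c (Some v) t) : v w / (v <= w)%O >-> leoo v w}.
    by move=> v1 v2 v12; apply: contour_homo.
  have [b bE] := shift_incl_contains shP chomo h vw a.
  by exists (e w b); rewrite me ntcompE bE.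
move=> B g gi; rewrite (hv_ninj btP normN) // => /contour_norm_coker_le gt x a.
have [u <-] := es x a; rewrite me ntcompE.
by apply: shift_incl_least => v w h vw; exact: gt.
Qed.

Lemma contour_norm_simple : is_simple_norm (contour_norm c : tame P K -> \bar R).
Proof.
split; first exact: normN.
split.
- exact: (hv_valuation btP normN).
- split; [exact: (hv_pushout_nonexpansive btP normN)|
    exact: (hv_pullback_nonexpansive btP normN)|
    exact: (hv_comp_subadditive btP normN)|exact: (hv_monotone btP normN)].
- exact: contour_direct_sum_max.
- by move=> t X; have [A [f [ft _]]] := contour_shift_exists t X; exists A, f.
move=> t X A f ft; have [B [g [gt gX]]] := contour_shift_exists t X.
apply: leq_trans gX; have [gm gt' _] := gt; have [fm ft' fmin] := ft.
have [k kE] := t_minimal_smallest btP normN contour_direct_sum_max gt (mono_ninj fm) ft'.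
have [k' k'E] := t_minimal_smallest btP normN contour_direct_sum_max ft (mono_ninj gm) gt'.
apply: (@beta0_nsurj _ _ _ B A k) => x a; exists (k' x a).
by apply: (ninjP (mono_ninj fm)); rewrite kE k'E.
Qed.

Lemma contour_is_Kshift v t : is_Kshift cn v t (c v t).
Proof.
have vw := contour_le v t; exists vw.
apply: smallest_t_minimal; first exact: Kincl_ninj.
  rewrite (hv_ninj btP normN); last exact: Kincl_ninj.
  apply/contour_norm_coker_le => z w h zw u.
  have [vz|vz] := boolP (leoo v (Some z)); last first.
    by exists 0%R; rewrite (Kfun_notin u vz) !lfun0.
  by apply: Kincl_surj; rewrite -zw; exact: contour_homo.
move=> B g gi; rewrite (hv_ninj btP normN) // => /contour_norm_coker_le gt x a.
have [cx|cx] := boolP (leoo (c v t) (Some x)); last first.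
  by exists 0%R; rewrite (Kfun_notin a cx) !lfun0.
case: v vw g gi gt a cx => [v|] vw g gi gt a cx; last first.
  by exfalso; move: cx; rewrite contour_None.
move: vw a cx; case vt : (c (Some v) t) => [w|] // vw a wx.
(* [B] contains the image at [w] of the generator at [v], which generates [K(w,-)]. *)
have [b bE] := gt v w vw vt (Kgen K (Some v) v).
have [k ->] := Kgen_span a; exists (k *: fmap B wx b)%R.
rewrite !lfunZ ntnatE bE Kgen_incl // (fmapME vw wx (le_trans vw wx)).
by rewrite Kgen_fmap /=.
Qed.

End ContourNorm.

(** * From norms to contours *)

Section NormContour.
Variables (disp : Order.disp_t) (P : joinSemilatticeType disp) (K : fieldType).
Variables (bt : P).
Hypothesis btP : forall x, (bt <= x)%O.
Local Notation M := (tame_cat P K).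
Local Notation "X ~> Y" := (@hom M X Y) (at level 60).
Variables (R : realType) (N : tame P K -> \bar R).
Hypothesis simpleN : is_simple_norm N.
Implicit Types (X Y Z A B C : tame P K) (s t : {nonneg R}) (u v w : option P).
Local Open Scope ereal_scope.
Local Notation hv := (homogeneous_valuation (N : M -> \bar R)).

Let normN : is_norm (N : M -> \bar R). Proof. by case: simpleN. Qed.
Let sum_max : direct_sum_max hv. Proof. by case: simpleN => _ []. Qed.

Definition Kincl_mor v w (vw : leoo v w) : Ktame K w ~> Ktame K v := Kincl K vw.

Lemma Kincl_mor_ninj v w (vw : leoo v w) : ninj (Kincl_mor vw).
Proof. exact: Kincl_ninj. Qed.

(** Evaluation at [u]: if [w] were not below it, the nonzero generator of [K(u,-)] would factor
    through zero. *)
Lemma Kincl_factor v w u (vw : leoo v w) (vu : leoo v u)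
    (k : nattrans (Kfun K u) (Kfun K w)) :
  (forall x a, Kincl K vw x (k x a) = Kincl K vu x a) -> leoo w u.
Proof.
case: u vu k => [x|] vu k kE; last by case: w vw k kE.
apply/negPn/negP => wx; apply: (@Kgen_neq0 _ P K v x vu).
rewrite -(Kgen_incl K vu (x := x)); last exact: leoo_refl.
by rewrite -kE (Kfun_notin (k x _) wx) lfun0.
Qed.

Lemma Kincl_mono v w u (vw : leoo v w) (vu : leoo v u) : leoo w u ->
  hv (Kincl_mor vw) <= hv (Kincl_mor vu).
Proof.
move=> wu; rewrite !(hv_ninj btP normN); try exact: Kincl_ninj.
apply: (norm_coker_surj btP normN (b := @idm M (Ktame K v))) => x a.
  rewrite tidE; have [ux|ux] := boolP (leoo u (Some x)).
    have [b bE] := Kincl_surj vw (Kincl K vu x a) (leoo_trans wu ux).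
    by exists b; exact: (esym bE).
  by exists 0%R; rewrite (Kfun_notin a ux) !lfun0.
by exists a, 0%R; rewrite tidE lfun0 addr0.
Qed.

(** The whole contour is read off this equivalence: [w <= v * t] iff
  [N (K(v,-) / K(w,-)) <= t]. *)
Lemma is_Kshift_le t v u : is_Kshift N v t u ->
  forall w (vw : leoo v w), leoo w u <-> hv (Kincl_mor vw) <= t%:num%:E.
Proof.
move=> [vu ut] w vw; split=> [wu|wt].
  by apply: le_trans (Kincl_mono vw vu wu) _; case: ut.
have [k kE] := t_minimal_smallest btP normN sum_max ut (@Kincl_mor_ninj v w vw) wt.
exact: Kincl_factor kE.
Qed.

(** By axiom (3) the shift has at most one generator, and a subfunctor of [K(v,-)] generated by one
    element at [p] is zero or [K(p,-)]. *)
Lemma is_Kshift_exists t v : exists u, is_Kshift N v t u.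
Proof.
have [_ [_ _ _ shift beta]] := simpleN.
have [A [f ft]] := shift t (Ktame K v); have fi := mono_ninj (let: And3 h _ _ := ft in h).
have bA : (beta0 A <= 1)%N.
  apply: leq_trans (beta t _ _ f ft) _.
  have [s [q [s1 qs]]] := kfree_generated K [:: v].
  apply: leq_trans s1; have [p pE] := fst_exists (Kfun K v) (Kfun K None).
  apply: (@beta0_le _ _ _ (Ktame K v) s (nt_comp p q)) => x a.
  by have [b bE] := qs x (a, 0%R); exists b; rewrite ntcompE pE bE.
have leNone : leoo v None by case: (v).
have zero : (forall x (a : A x), a = 0%R) -> is_Kshift N v t None.
  move=> A0; exists leNone.
  apply: (t_minimal_image btP normN ft (@Kincl_mor_ninj v None leNone)) => x a.
    by exists 0%R; rewrite (A0 x a) !lfun0.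
  by exists 0%R; rewrite (Kfun_notin a) // !lfun0.
have /generated_byP [s [q [sA qs]]] := beta0_generated A.
move: bA; rewrite -sA; case: s q sA qs => [|p [|//]] q sA qs _.
  by exists None; apply: zero => x a; have [b <-] := qs x a; rewrite (Kfun_notin b) // lfun0.
have [i iE] := inl_exists (Kfun K (Some p)) (Kfun K None).
have qi x a : exists b, a = q x (i x b).
  have [[b b'] <-] := qs x a; exists b; rewrite iE.
  by congr (q x (_, _)); exact: Kfun_notin.
pose r : nattrans (Kfun K (Some p)) (Kfun K v) := nt_comp f (nt_comp q i).
have rE x a : r x a = f x (q x (i x a)) by rewrite !ntcompE.
have rgen x (px : (p <= x)%O) : r x (Kgen K (Some p) x) =
    fmap (Kfun K v) px (r p (Kgen K (Some p) p)) by exact: nt_gen_fmap.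
have [r0|/eqP r0] := eqVneq (r p (Kgen K (Some p) p)) 0%R.
  exists None; apply: zero => x a; apply: (fi x).
  have [b ->] := qi x a; rewrite -rE.
  have [px|px] := boolP (p <= x)%O; last by rewrite (Kfun_notin b px) lfun0.
  by have [k ->] := Kgen_span b; rewrite lfunZ (rgen x px) r0 lfun0 scaler0.
have vp : leoo v (Some p).
  by apply/negPn/negP => vp; apply: r0; rewrite (Kfun_notin (r p _) vp).
exists (Some p), vp.
apply: (t_minimal_image btP normN ft (@Kincl_mor_ninj v (Some p) vp)) => x a.
  have [b ->] := qi x a; rewrite -rE.
  have [px|px] := boolP (p <= x)%O; first exact: Kincl_surj.
  by exists 0%R; rewrite (Kfun_notin b px) !lfun0.
have [px|px] := boolP (p <= x)%O; last first.
  by exists 0%R; rewrite (Kfun_notin a px) !lfun0.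
have [k rk] := Kgen_span (r p (Kgen K (Some p) p)).
have k0 : k != 0%R by apply/eqP => k0; apply: r0; rewrite rk k0 scale0r.
(* The generator of [A] is sent to [k] times the standard one, hence the factor [l / k]. *)
have [l ->] := Kgen_span a; exists ((l / k)%R *: q x (i x (Kgen K (Some p) x)))%R.
by rewrite !lfunZ -rE (rgen x px) rk lfunZ scalerA divfK // Kgen_fmap // Kgen_incl.
Qed.

Lemma leoo_anti v w : leoo v w -> leoo w v -> v = w.
Proof.
case: v w => [v|] [w|] //= vw wv; congr Some.
by apply/le_anti; rewrite vw wv.
Qed.

Lemma is_Kshift_unique t v u u' : is_Kshift N v t u -> is_Kshift N v t u' -> u = u'.
Proof.
move=> uu uu'; have [vu ut] := uu; have [vu' ut'] := uu'.
apply: leoo_anti.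
  by apply/(is_Kshift_le uu' vu)/(is_Kshift_le uu vu); exact: leoo_refl.
by apply/(is_Kshift_le uu vu')/(is_Kshift_le uu' vu'); exact: leoo_refl.
Qed.

Lemma norm_contourP v t : is_Kshift N v t (norm_contour N v t).
Proof. by rewrite /norm_contour; apply: xgetPex; exact: is_Kshift_exists. Qed.

Lemma norm_contour_unique v t u : is_Kshift N v t u -> norm_contour N v t = u.
Proof. exact: (is_Kshift_unique (norm_contourP v t)). Qed.

Lemma norm_contour_le v t : leoo v (norm_contour N v t).
Proof. by have [vw _] := norm_contourP v t. Qed.

Lemma norm_contour_leP v w t (vw : leoo v w) :
  leoo w (norm_contour N v t) <-> hv (Kincl_mor vw) <= t%:num%:E.
Proof. exact: is_Kshift_le (norm_contourP v t) w vw. Qed.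

Definition joino v w : option P :=
  if v is Some x then if w is Some y then Some (Order.join x y) else None else None.

Lemma leoo_joino v w z : leoo (joino v w) z = leoo v z && leoo w z.
Proof. by case: v w z => [v|] [w|] [z|] //=; rewrite ?andbF ?leUx. Qed.

Lemma leoo_joinl v w : leoo v (joino v w).
Proof. by have := leoo_refl (joino v w); rewrite leoo_joino => /andP[]. Qed.

Lemma leoo_joinr v w : leoo w (joino v w).
Proof. by have := leoo_refl (joino v w); rewrite leoo_joino => /andP[]. Qed.

(** Inside [K(v,-)], the intersection of [K(w,-)] and [K(u,-)] is [K] of their join, so the quotient
    of [K(w,-)] embeds in that of [K(v,-)]. *)
Lemma Kincl_restrict v w u (vw : leoo v w) (vu : leoo v u) :
  hv (Kincl_mor (leoo_joinl w u)) <= hv (Kincl_mor vu).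
Proof.
rewrite !(hv_ninj btP normN); try exact: Kincl_ninj.
apply: (norm_coker_inj btP normN (b := Kincl_mor vw)) => x a.
  have [jx|jx] := boolP (leoo (joino w u) (Some x)).
    have [b bE] := Kincl_surj vu (Kincl K vw x (Kincl K (leoo_joinl w u) x a))
      (leoo_trans (leoo_joinr w u) jx).
    by exists b; rewrite bE.
  by exists 0%R; rewrite (Kfun_notin a jx) !lfun0.
move=> b ab; have [wx|wx] := boolP (leoo w (Some x)); last first.
  by exists 0%R; rewrite (Kfun_notin a wx) !lfun0.
have [ux|ux] := boolP (leoo u (Some x)).
  by apply: Kincl_surj; rewrite leoo_joino wx ux.
exists 0%R; rewrite lfun0; symmetry; apply: (Kincl_ninj (vw := vw)).
by rewrite ab (Kfun_notin b ux) lfun0.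
Qed.

Lemma norm_contour_is_contour : is_contour (norm_contour N).
Proof.
split.
- exact: norm_contour_le.
- move=> v w s t vw st; have vp := norm_contour_le v s.
  (* [norm_contour_leP] tests only points above [w], so [v * s] is replaced by its join with [w]. *)
  apply: leoo_trans (leoo_joinr w _) _.
  apply/(norm_contour_leP t (leoo_joinl w _)).
  apply: le_trans (Kincl_restrict vw vp) _.
  apply: (@le_trans _ _ s%:num%:E); last by rewrite lee_fin.
  by apply/norm_contour_leP; exact: leoo_refl.
- move=> v s t; have vp := norm_contour_le v s.
  have pq := norm_contour_le (norm_contour N v s) t.
  apply/(norm_contour_leP _ (leoo_trans vp pq)).
  have -> : Kincl_mor (leoo_trans vp pq) = Kincl_mor vp \c Kincl_mor pq.
    apply: hom_eq => x a; rewrite tcompE /Kincl_mor.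
    have [qx|qx] := boolP (leoo (norm_contour N (norm_contour N v s) t) (Some x)).
      have [k ->] := Kgen_span a; rewrite !lfunZ !Kgen_incl //.
      exact: leoo_trans pq qx.
    by rewrite (Kfun_notin a qx) !lfun0.
  apply: le_trans (hv_comp_subadditive btP normN _ _) _.
  rewrite /= EFinD addeC; apply: leeD.
    by apply/norm_contour_leP; exact: leoo_refl.
  by apply/norm_contour_leP; exact: leoo_refl.
(* The threshold [a] of axiom (4) is the value of the inclusion of [K] of the join of [v] and [w] in
   [K(v,-)]; if it is infinite, [w] is never reached. *)
move=> v w; have vj := leoo_joinl v w.
have le_join t : leoo w (norm_contour N v t) =
    (hv (Kincl_mor vj) <= t%:num%:E) :> bool.
  apply/idP/idP => [wt|/norm_contour_leP]; last by rewrite leoo_joino => /andP[].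
  by apply/norm_contour_leP; rewrite leoo_joino norm_contour_le.
have : 0 <= hv (Kincl_mor vj) by case: (hv_valuation btP normN).
case: (hv (Kincl_mor vj)) le_join => [a| |] // le_join a0; last first.
  by left=> t; rewrite le_join.
by right; exists (NngNum (a0 : (0 <= a)%R)) => t; rewrite le_join lee_fin.
Qed.

Let c := norm_contour N.
Let cc : is_contour c := norm_contour_is_contour.

Lemma norm_le_vanishing t X : N X <= t%:num%:E <-> contour_vanishing c t X.
Proof.
split=> [Xt v w h vw y|Xt].
  have [f fE] := yoneda y.
  have [I [e [m [es mi me]]]] := @tame_image_exists _ P K bt btP (Ktame K (Some v)) X f.
  have [B [g [gi ge]]] := @tame_kernel_exists _ P K bt btP (Ktame K (Some v)) I e.
  (* The quotient of [K(v,-)] by [B] is a subfunctor of [X]. Hence [B] contains the shift [K(w,-)],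
     which therefore dies in [X]. *)
  have gt : hv (g : B ~> Ktame K (Some v)) <= t%:num%:E.
    rewrite (hv_ninj btP normN) // (norm_coker_cokernel btP normN es ge).
    by apply: le_trans Xt; exact: (norm_inj btP normN mi).
  have [vw' wt] : is_Kshift N (Some v) t (Some w) by rewrite -vw; exact: norm_contourP.
  have [k kE] := t_minimal_smallest btP normN sum_max wt gi gt.
  rewrite -fE -nt_gen_fmap -me -(Kgen_incl K vw' (x := w)) /=; last exact: lexx.
  by rewrite -kE (ge w _).2 ?lfun0 //; eexists.
have [S SX] := tame_fdet (tameP X); have [s [q qs]] := fdet_generated btP SX.
have shP (v : P) : leoo (Some v) (c (Some v) t) by exact: norm_contour_le.
have tame_free (l : seq P) : is_tame (free K l) := fdet_tame btP (@fdet_free _ P K l).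
pose F l : tame P K := Tame (tame_free l).
pose G l : tame P K := Tame (tame_kfree K btP [seq c (Some x) t | x <- l]).
pose phi l : G l ~> F l := shift_incl K shP l.
have phit : hv (phi s) <= t%:num%:E.
  elim: s {q qs} => [|v s IH].
    have [_ iso _] := hv_valuation btP normN.
    rewrite iso ?lee_fin //; apply: bij_iso => x a; first by move=> _; exact: Kfun_notin.
    by exists 0%R; rewrite [RHS](Kfun_notin a) // lfun0.
  apply: (@le_trans _ _ (maxe (hv (Kincl_mor (shP v))) (hv (phi s)))); last first.
    rewrite ge_max IH andbT; apply/norm_contour_leP; exact: leoo_refl.
  apply: sum_max; [exact/ninj_mono/Kincl_ninj|exact/ninj_mono/shift_incl_ninj|].
  have [i1 i1E] := inl_exists (Kfun K (c (Some v) t)) (kfree K [seq c (Some x) t | x <- s]).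
  have [i2 i2E] := inr_exists (Kfun K (c (Some v) t)) (kfree K [seq c (Some x) t | x <- s]).
  have [j1 j1E] := inl_exists (Kfun K (Some v)) (free K s).
  have [j2 j2E] := inr_exists (Kfun K (Some v)) (free K s).
  exists (i1 : Ktame K _ ~> G (v :: s)), (i2 : G s ~> G (v :: s)).
  exists (j1 : Ktame K _ ~> F (v :: s)), (j2 : F s ~> F (v :: s)); split.
  - exact: (@is_coproduct_dirsum _ P K bt btP (Ktame K _) (G s)).
  - exact: (@is_coproduct_dirsum _ P K bt btP (Ktame K _) (F s)).
  - by apply: hom_eq => x a; rewrite !tcompE i1E j1E shift_inclE /= lfun0.
  - by apply: hom_eq => x a; rewrite !tcompE i2E j2E shift_inclE /= lfun0.
(* Writing [X] as the cokernel of a zero map lets the cover [q] compare it with the cokernel of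
   [phi s]. *)
rewrite -(norm_coker_zerom btP normN (Ktame K None) X).
apply: le_trans phit.
rewrite (hv_ninj btP normN); last exact: shift_incl_ninj.
apply: (norm_coker_surj btP normN (b := q : F s ~> X)) => x a; last first.
  by have [b <-] := qs x a; exists b, 0%R; rewrite lfun0 addr0.
(* With [g] zero this says that [q] kills the shifted free functor. *)
have [|b bE] := shift_incl_least (sh := fun x => c (Some x) t) shP q (g := nt_zero (Kfun K None) X) _ a.
  by move=> v w h vw y; exists 0%R; rewrite lfun0 Xt.
by exists b; rewrite -bE.
Qed.

Lemma contour_norm_norm_contour X : contour_norm c X = N X.
Proof.
have cn0 := contour_norm_ge0 c X; have N0 := norm_ge0 normN X.
apply/le_anti/andP; split; apply: le_nonneg => // t.
  by move=> /norm_le_vanishing Xt; apply/(contour_norm_le cc).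
by move=> /(contour_norm_le cc) Xt; apply/norm_le_vanishing.
Qed.

End NormContour.

Lemma contour_norm_bijection (disp : Order.disp_t) (P : joinSemilatticeType disp)
    (K : fieldType) (R : realType) (bt : P) (btP : forall x, (bt <= x)%O) :
  [/\ forall c : option P -> {nonneg R} -> option P, is_contour c ->
        is_simple_norm (contour_norm c : tame P K -> \bar R),
      forall N : tame P K -> \bar R, is_simple_norm N ->
        (forall (v : option P) (t : {nonneg R}), exists! w, is_Kshift N v t w)
        /\ is_contour (norm_contour N),
      forall c : option P -> {nonneg R} -> option P, is_contour c ->
        norm_contour (contour_norm c : tame P K -> \bar R) = c
    & forall N : tame P K -> \bar R, is_simple_norm N ->
        contour_norm (norm_contour N) = N].
Proof.
split.
- by move=> c cc; exact: contour_norm_simple.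
- move=> N sN; split; last exact: norm_contour_is_contour.
  move=> v t; have [u ut] := is_Kshift_exists btP sN t v.
  by exists u; split=> // w; exact: is_Kshift_unique.
- move=> c cc; apply/funext => v; apply/funext => t.
  have sN := @contour_norm_simple _ P K bt btP R c cc.
  apply: (@norm_contour_unique _ P K bt btP R _ sN v t).
  exact: contour_is_Kshift.
- by move=> N sN; apply/funext => X; exact: contour_norm_norm_contour.
Qed.

Theorem mainTheorem5 (R : realType) (K : fieldType) (l : nat) :
  let P := orthant R l in
  [/\ forall c : option P -> {nonneg R} -> option P, is_contour c ->
        is_simple_norm (contour_norm c : tame P K -> \bar R),
      forall N : tame P K -> \bar R, is_simple_norm N ->
        (forall (v : option P) (t : {nonneg R}), exists! w, is_Kshift N v t w)
        /\ is_contour (norm_contour N),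
      forall c : option P -> {nonneg R} -> option P, is_contour c ->
        norm_contour (contour_norm c : tame P K -> \bar R) = c
    & forall N : tame P K -> \bar R, is_simple_norm N ->
        contour_norm (norm_contour N) = N].
Proof.
move=> P; have z0 : 0 <= 0 :> R by [].
(* The type is spelled out because [orthant] is declared as a mere poset, while joins are needed;
   the least element is the origin. *)
pose bt : l.-tupleprod {nonneg R} := [tuple of nseq l (NngNum z0)].
apply: (@contour_norm_bijection _ (l.-tupleprod {nonneg R}) K R bt) => x.
rewrite Order.TupleProdOrder.leEtprod; apply/forallP => i.
have x0 : 0 <= (tnth x i)%:num by [].
by rewrite tnth_nseq; exact: x0.
Qed.
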